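(* Let $s_i\in\mathbb{R}$, $0<p_i<\infty$, $0<q_i\le\infty$, and $\varphi_i\in\mathcal{G}_{p_i}$ for $i=1,2$. Assume (without loss of generality) that $\varphi_1(1)=\varphi_2(1)=1$. Let $\varrho=\min\big(1,\frac{p_1}{p_2}\big)$ and $\alpha_j=\sup_{\nu\in\mathbb{Z},\,\nu\le j}\frac{\varphi_2(2^{-\nu})}{\varphi_1(2^{-\nu})^{\varrho}}$, $j\in\mathbb{N}_0$. There is a continuous embedding $$n^{s_1}_{\varphi_1,p_1,q_1}\hookrightarrow n^{s_2}_{\varphi_2,p_2,q_2}$$ if and only if $$\sup_{\nu\in\mathbb{Z},\,\nu\le0}\frac{\varphi_2(2^{-\nu})}{\varphi_1(2^{-\nu})^{\varrho}}<\infty$$ and $$\Big\{2^{j(s_2-s_1)}\alpha_j\frac{\varphi_1(2^{-j})^{\varrho}}{\varphi_1(2^{-j})}\Big\}_{j\in\mathbb{N}_0}\in\ell_{q^*},\qquad\text{where}\quad\frac1{q^*}=\Big(\frac1{q_2}-\frac1{q_1}\Big)_+.$$ The embedding $n^{s_1}_{\varphi_1,p_1,q_1}\hookrightarrow n^{s_2}_{\varphi_2,p_2,q_2}$ is never compact.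
   Context: Fix $d\in\mathbb{N}$; $\mathbb{N}_0=\mathbb{N}\cup\{0\}$, $a_+=\max(a,0)$, $q^*=\infty$ if $1/q^*=0$. Class $\mathcal{G}_p$ ($0<p<\infty$): all nondecreasing $\varphi:(0,\infty)\to[0,\infty)$ such that $\varphi(t)t^{-d/p}$ is nonincreasing, i.e. $1\le\varphi(r)/\varphi(t)\le(r/t)^{d/p}$ for $0<t\le r<\infty$ (in particular $\varphi>0$). Dyadic cubes: $Q_{j,k}=2^{-j}([0,1)^d+k)$, $j\in\mathbb{Z},k\in\mathbb{Z}^d$, collected in $\mathcal{Q}$; $\ell(Q)$ is the side length and $|Q|$ the volume. The generalised Morrey space $\mathcal{M}_{\varphi,p}(\mathbb{R}^d)$ consists of all $f\in L_p^{\mathrm{loc}}(\mathbb{R}^d)$ with $\|f\mid\mathcal{M}_{\varphi,p}(\mathbb{R}^d)\|=\sup_{Q\in\mathcal{Q}}\varphi(\ell(Q))\big(\frac1{|Q|}\int_Q|f(y)|^p\,dy\big)^{1/p}<\infty$. For $s\in\mathbb{R}$, $0<q\le\infty$, $\varphi\in\mathcal{G}_p$, the sequence space $n^s_{\varphi,p,q}=n^s_{\varphi,p,q}(\mathbb{R}^d)$ is the set of complex sequences $\lambda=\{\lambda_{j,m}\}_{j\in\mathbb{N}_0,m\in\mathbb{Z}^d}$ with $\|\lambda\mid n^s_{\varphi,p,q}\|=\big(\sum_{j=0}^\infty2^{jsq}\big\|\sum_{m\in\mathbb{Z}^d}\lambda_{j,m}\chi_{Q_{j,m}}\mid\mathcal{M}_{\varphi,p}(\mathbb{R}^d)\big\|^q\big)^{1/q}<\infty$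 (usual modification if $q=\infty$). $X\hookrightarrow Y$ means $X\subset Y$ with continuous natural embedding (for quasi-Banach spaces). *)

(* Defs.v *)
From HB Require Import structures.
From mathcomp Require Import all_boot all_order all_algebra.
From mathcomp Require Import all_classical all_reals all_analysis.
From mathcomp Require Export complex.

Set Implicit Arguments.
Unset Strict Implicit.
Unset Printing Implicit Defensive.
Import Order.TTheory GRing.Theory Num.Theory.
Import numFieldNormedType.Exports.

Local Open Scope classical_set_scope.
Local Open Scope ring_scope.

Section lebesgue_tuple.
Context {R : realType}.

Definition tuple_cons n (x : R * n.-tuple R) : n.+1.-tuple R :=
  [tuple of x.1 :: x.2].

Lemma measurable_tuple_cons n : measurable_fun setT (@tuple_cons n).
Proof. exact: measurable_cons. Qed.

Section step.
Variables (n : nat) (m : {sigma_finite_measure set (n.-tuple R) -> \bar R}).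

Definition lebesgue_tupleS : set (n.+1.-tuple R) -> \bar R :=
  pushforward (lebesgue_measure \x m)%E (@tuple_cons n).

Let lebesgue_tupleS0 : lebesgue_tupleS set0 = 0%E.
Proof. by rewrite /lebesgue_tupleS /pushforward preimage_set0 measure0. Qed.

Let lebesgue_tupleS_ge0 A : (0 <= lebesgue_tupleS A)%E.
Proof. by rewrite /lebesgue_tupleS /pushforward measure_ge0. Qed.

Let lebesgue_tupleS_sigma_additive : semi_sigma_additive lebesgue_tupleS.
Proof.
exact: (@measure_semi_sigma_additive _ _ _
  (measure_function_pushforward__canonical__measure_function_Measure
    (lebesgue_measure \x m)%E (@measurable_tuple_cons n))).
Qed.

HB.instance Definition _ := isMeasure.Build _ _ _ lebesgue_tupleS
  lebesgue_tupleS0 lebesgue_tupleS_ge0 lebesgue_tupleS_sigma_additive.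

Let lebesgue_tupleS_sigma_finite : sigma_finite setT lebesgue_tupleS.
Proof.
have /sigma_finiteP[F [TF ndF Foo]] :=
  sigma_finiteT (@lebesgue_measure R : {sigma_finite_measure set _ -> \bar R}).
have /sigma_finiteP[G [TG ndG Goo]] := sigma_finiteT m.
pose g (x : n.+1.-tuple R) : measurableTypeR R * n.-tuple R :=
  (thead x, [tuple of behead x]).
have gK : cancel (@tuple_cons n) g.
  by move=> [a t]; rewrite /g theadE; congr pair; exact/val_inj.
have mg : measurable_fun setT g.
  apply/measurable_fun_pair; first exact: measurable_tnth.
  exact: measurable_behead.
exists (fun i => g @^-1` (F i `*` G i)).
  rewrite -preimage_bigcup predeqE => t; split=> // _.
  have [i _ Fi] : (\bigcup_i F i) (g t).1 by rewrite -TF.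
  have [j _ Gj] : (\bigcup_i G i) (g t).2 by rewrite -TG.
  exists (maxn i j) => //; split.
    by move: Fi; exact/subsetPset/ndF/leq_maxl.
  by move: Gj; exact/subsetPset/ndG/leq_maxr.
move=> i; have [mF Fi] := Foo i; have [mG Gi] := Goo i; split.
  by rewrite -[X in measurable X]setTI; apply: mg => //; exact: measurableX.
rewrite /lebesgue_tupleS /pushforward -comp_preimage.
rewrite (_ : g \o _ = id); last by apply/funext => x /=; rewrite gK.
by rewrite preimage_id product_measure1E// lte_mul_pinfty// ge0_fin_numE.
Qed.

HB.instance Definition _ := Measure_isSigmaFinite.Build _ _ _ lebesgue_tupleS
  lebesgue_tupleS_sigma_finite.

End step.

(* Lebesgue measure on the Borel sets of R^n: the n-fold product of the
   one-dimensional Lebesgue measure; R^0 is a point, of mass one *)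
Fixpoint lebesgue_tuple n : {sigma_finite_measure set (n.-tuple R) -> \bar R} :=
  if n is k.+1 then lebesgue_tupleS (lebesgue_tuple k) else dirac [tuple].

End lebesgue_tuple.

Lemma lebesgue_tuple_box {R : realType} n (a b : n.-tuple R) :
    (forall i, tnth a i <= tnth b i) ->
  lebesgue_tuple n [set x | forall i, tnth a i <= tnth x i < tnth b i] =
    (\prod_(i < n) (tnth b i - tnth a i))%:E.
Proof.
elim: n a b => [|n IH] a b ab.
  rewrite big_ord0 /= diracE mem_set//.
  by case.
case/tupleP: a ab => a0 a; case/tupleP: b => b0 b ab.
rewrite big_ord_recl /= /lebesgue_tupleS /pushforward.
pose B := [set x : n.-tuple R | forall i, tnth a i <= tnth x i < tnth b i].
have mB : measurable B.
  rewrite (_ : B = \bigcap_(i in [set: 'I_n])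
      ((fun x : n.-tuple R => tnth x i) @^-1` `[tnth a i, tnth b i[%classic)).
    apply: fin_bigcap_measurable; first exact: finite_finset.
    move=> i _; rewrite -[X in measurable X]setTI.
    by apply: measurable_tnth => //; exact: measurable_itv.
  rewrite predeqE => x; split => [Bx i _|Bx i].
    by rewrite /= in_itv /=; exact: Bx.
  by have := Bx i I; rewrite /= in_itv.
rewrite (_ : _ @^-1` _ = `[a0, b0[%classic `*` B); last first.
  rewrite predeqE => -[x0 x] /=; rewrite in_itv /=; split.
    move=> h; split; first by have := h ord0; rewrite !tnth0.
    by move=> i; have := h (lift ord0 i); rewrite !tnthS.
  move=> [h0 h] i; case: (unliftP ord0 i) => [j|] ->; last by rewrite !tnth0.
  by rewrite !tnthS; exact: h.
rewrite product_measure1E//.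
have a0b0 : a0 <= b0 by have := ab ord0; rewrite !tnth0.
rewrite [X in (X * _)%E](_ : _ = (b0 - a0)%:E); last first.
  apply: (etrans (lebesgue_measure_itv _)); rewrite /= lte_fin.
  by case: ltgtP a0b0 => // ->; rewrite subrr.
rewrite IH; last by move=> i; have := ab (lift ord0 i); rewrite !tnthS.
rewrite -EFinM !tnth0; congr (_ * _)%:E.
by apply: eq_bigr => i _; rewrite !tnthS.
Qed.

(* A quasi-norm is given as a gauge N on an ambient group, with the value +oo
   allowed; it stands for the quasi-normed space of the points where N is
   finite. *)
Section gauge_spaces.
Context {R : realType} {V : zmodType}.
Implicit Types N : V -> \bar R.

Definition gauge_space N : set V := [set x | (N x < +oo)%E].

Definition continuously_embedded N1 N2 :=
  gauge_space N1 `<=` gauge_space N2 /\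
  forall x, gauge_space N1 x -> forall e : R, 0 < e ->
    exists2 r : R, 0 < r & forall y, gauge_space N1 y ->
      (N1 (y - x)%R < r%:E)%E -> (N2 (y - x)%R < e%:E)%E.

Definition compactly_embedded N1 N2 :=
  continuously_embedded N1 N2 /\
  forall u : nat -> V, (exists C : R, forall n, (N1 (u n) <= C%:E)%E) ->
    exists sigma : nat -> nat, {homo sigma : m n / (m < n)%N} /\
    exists2 y, gauge_space N2 y &
      N2 (u (sigma n) - y) @[n --> \oo] --> 0%E.

End gauge_spaces.

Section sequence_spaces.
Context {R : realType}.

(* Only the values on (0, oo) matter. Strict positivity rules out phi = 0, which
   the two monotonicity conditions alone would allow. *)
Definition growth_class (d : nat) (p : R) (phi : R -> R) :=
  [/\ forall t, 0 < t -> 0 < phi t,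
      forall t r, 0 < t -> t <= r -> phi t <= phi r &
      forall t r, 0 < t -> t <= r ->
        phi r * r `^ (- (d%:R / p)) <= phi t * t `^ (- (d%:R / p))].

Definition side (j : int) : R := 2 ^ (- j).

Definition dyadic_cube d (j : int) (k : d.-tuple int) : set (d.-tuple R) :=
  [set x | forall i, side j * (tnth k i)%:~R <= tnth x i
                       < side j * ((tnth k i)%:~R + 1)].

(* Morrey quasi-norm, with value +oo when f is not in the space *)
Definition morrey_norm d (phi : R -> R) (p : R) (f : d.-tuple R -> R[i]) :
    \bar R :=
  ereal_sup [set ((phi (side jk.1))%:E *
    ((lebesgue_tuple d (dyadic_cube jk.1 jk.2))^-1 *
     \int[lebesgue_tuple d]_(x in dyadic_cube jk.1 jk.2)
       (Normc.normc (f x) `^ p)%:E) `^ p^-1)%E | jk in [set: int * d.-tuple int]].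

(* At each point at most one term of the sum is nonzero. *)
Definition step_fun d (c : d.-tuple int -> R[i]) (j : nat) :
    d.-tuple R -> R[i] :=
  fun x => \sum_(m \in [set: d.-tuple int]) c m * \1_(dyadic_cube j m) x.

Definition ell_norm (q : \bar R) (u : nat -> \bar R) : \bar R :=
  Lnorm (counting : {measure set nat -> \bar R}) q u.

(* The step functions are Borel and constant on the cubes of one level, so
   they belong to the Morrey space as soon as their quasi-norm is finite. *)
Definition n_norm d (s : R) (phi : R -> R) (p : R) (q : \bar R)
    (lam : nat -> d.-tuple int -> R[i]) : \bar R :=
  ell_norm q (fun j =>
    (2 `^ (j%:R * s))%:E * morrey_norm phi p (step_fun (lam j) j))%E.

Definition alpha (phi1 phi2 : R -> R) (rho : R) (j : nat) : \bar R :=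
  ereal_sup [set (phi2 (side nu) / phi1 (side nu) `^ rho)%:E |
             nu in [set nu : int | nu <= j%:Z]].

(* the exponent q* with 1/q* = (1/q2 - 1/q1)_+; in \bar R the inverses of 0
   and +oo are each other *)
Definition qstar (q1 q2 : \bar R) : \bar R := (maxe (q2^-1 - q1^-1) 0)^-1%E.

End sequence_spaces.

(* Main.v *)
(** A function [f] that is constant on the cubes of level [j] has Morrey norm
    sup_(n, k) phi(2^-(j-n)) (mean of |f|^p over Q_(j-n,k))^(1/p), since finer cubes
    contribute less. Between two Morrey norms of such functions the best constant is,
    up to a factor, alpha_j phi1(2^-j)^(rho-1): for the upper bound use Jensen if
    p1 >= p2, and |f| <= phi1(2^-j)^-1 ||f||_1 if p1 < p2; for the lower bound take the
    indicator of a Cantor set whose density in each dyadic cube is as large as the first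
    norm allows. The embedding thus reduces to boundedness of multiplication by
    2^(j(s2-s1)) alpha_j phi1(2^-j)^(rho-1) from l_q1 to l_q2, i.e. to membership of that
    sequence in l_q*. Translates of a single unit coefficient at level 0 are bounded in
    the source and stay at distance 1 in the target, so no embedding is compact. *)

Require Import Defs.
From mathcomp Require Import all_boot all_order all_algebra finmap.
From mathcomp Require Import all_classical all_reals all_analysis.
From mathcomp Require Import measurable_realfun ess_sup_inf.
From mathcomp Require Import lra ring zify.
Import Order.TTheory GRing.Theory Num.Theory.
Local Open Scope classical_set_scope.
Local Open Scope ring_scope.

Set Implicit Arguments.
Unset Strict Implicit.
Unset Printing Implicit Defensive.

(** * Quasi-norms of sequences *)

Section weighted_sequences.
Context {R : realType}.
Implicit Types (q : \bar R) (u a b : nat -> R) (U : nat -> \bar R) (C D : R).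

(** For finite [q] the condition compares partial sums of powers with a power of [C], so that
    quasi-norm bounds become statements about finite real sums. The second branch serves
    [q = +oo]. *)
Definition ell_bound q u C : Prop :=
  if q is r%:E then forall K, \sum_(k < K) u k `^ r <= C `^ r
  else forall k, u k <= C.

Lemma ler_powR_base (r x y : R) : 0 < r -> 0 <= x -> 0 <= y ->
  (x `^ r <= y `^ r) = (x <= y).
Proof.
move=> r0 x0 y0; apply/idP/idP => h; last first.
  by apply: ge0_ler_powR => //; rewrite ?nnegrE// ltW.
have := @ge0_ler_powR R r^-1 _ (x `^ r) (y `^ r).
rewrite !nnegrE !powR_ge0 invr_ge0 => /(_ (ltW r0) isT isT h).
by rewrite -!powRrM mulfV ?gt_eqF// !powRr1.
Qed.

(** A set of counting measure zero is empty. Hence the essential supremum defining the case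
    [q = +oo] is a plain supremum. *)
Lemma counting_ae (P : nat -> Prop) :
  (\forall k \ae (counting : {measure set nat -> \bar R}), P k) -> forall k, P k.
Proof.
move=> [N [_ N0 sub]] k; apply: contrapT => nPk.
have Nk : N k by exact: sub.
move: N0; rewrite /= /counting; case: asboolP => // fN /eqP.
rewrite eqe pnatr_eq0 cardfs_eq0 => /eqP/fset_set_set0 N0.
by move: Nk; rewrite N0.
Qed.

Lemma counting_setT_gt0 :
  (0 < (counting : {measure set nat -> \bar R}) [set: nat])%E.
Proof.
rewrite /= /counting; case: asboolP => [fT|_]; last exact: ltry.
by have := infinite_nat => /(_ fT).
Qed.

Lemma ell_normy_le U C : (forall k, 0 <= U k)%E ->
  (ell_norm +oo U <= C%:E)%E <-> (forall k, U k <= C%:E)%E.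
Proof.
move=> U0; rewrite /ell_norm unlock counting_setT_gt0; split.
  move=> /ess_supP/counting_ae h k.
  by rewrite -[leLHS]gee0_abs//; exact: h.
move=> h; apply/ess_supP; apply: nearW => k /=.
by rewrite gee0_abs.
Qed.

Lemma ell_norm_le q u C : (0 < q)%E -> (forall k, 0 <= u k) -> 0 <= C ->
  (ell_norm q (EFin \o u) <= C%:E)%E <-> ell_bound q u C.
Proof.
case: q => [r| |]// q0 u0 C0; last first.
  rewrite ell_normy_le; last by move=> k; rewrite lee_fin.
  by split=> h k; have := h k; rewrite lee_fin.
rewrite lte_fin in q0.
rewrite /ell_norm Lnorm_counting// /ell_bound.
rewrite (eq_eseriesr (g := fun k => (u k `^ r)%:E)); last first.
  by move=> k _ /=; rewrite ger0_norm.
have E0 : (0 <= \sum_(k <oo) (u k `^ r)%:E)%E.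
  by apply: nneseries_ge0 => k _; rewrite lee_fin powR_ge0.
have -> : ((\sum_(k <oo) (u k `^ r)%:E) `^ r^-1 <= C%:E)%E =
    (\sum_(k <oo) (u k `^ r)%:E <= (C `^ r)%:E)%E.
  case: (\sum_(k <oo) _)%E E0 => [x| |]//.
    rewrite lee_fin => x0; rewrite poweR_EFin !lee_fin.
    by rewrite -(ler_powR_base q0) ?powR_ge0// -powRrM mulVf ?gt_eqF// powRr1.
  by move=> _; rewrite poweRyr ?invr_eq0 ?gt_eqF// !leye_eq.
split=> [h K|h].
  rewrite -lee_fin -sumEFin -(big_mkord xpredT (fun k => (u k `^ r)%:E)).
  by apply: le_trans h; apply: nneseries_lim_ge => k _; rewrite lee_fin powR_ge0.
apply: lime_le.
  by apply: is_cvg_nneseries => k _ _; rewrite lee_fin powR_ge0.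
by apply: nearW => K; rewrite big_mkord sumEFin lee_fin.
Qed.

Lemma ell_norm_ge_term q U k : (0 < q)%E -> (forall k, 0 <= U k)%E ->
  (U k <= ell_norm q U)%E.
Proof.
case: q => [r| |]// q0 U0; last first.
  case E : (ell_norm _ _) => [C| |]//; last 2 first.
  - by rewrite leey.
  - by have := Lnorm_ge0 (counting : {measure set nat -> \bar R}) +oo U;
      rewrite -/(ell_norm +oo U) E.
  by apply: (ell_normy_le C U0).1; rewrite E.
rewrite lte_fin in q0.
rewrite /ell_norm Lnorm_counting//.
have -> : U k = ((`|U k| `^ r) `^ r^-1)%E.
  by rewrite -poweRrM mulfV ?gt_eqF// poweRe1 ?gee0_abs.
apply: gt0_ler_poweR.
- by rewrite invr_ge0 ltW.
- by rewrite in_itv /= poweR_ge0 leey.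
- by rewrite in_itv /= leey andbT nneseries_ge0// => ? _; rewrite poweR_ge0.
apply: le_trans (nneseries_lim_ge k.+1 _) => [|? _]; last by rewrite poweR_ge0.
rewrite big_nat_recr//= leeDr// sume_ge0// => ? _; exact: poweR_ge0.
Qed.

(** Every term is at most the quasi-norm, so a finite quasi-norm forces all terms to be real and
    [fine] loses nothing. *)
Lemma ell_norm_ltyP q U : (0 < q)%E -> (forall k, 0 <= U k)%E ->
  (ell_norm q U < +oo)%E <->
  exists u C, [/\ U = EFin \o u, forall k, 0 <= u k, 0 <= C & ell_bound q u C].
Proof.
move=> q0 U0; split=> [h|[u [C [-> u0 C0 h]]]]; last first.
  by apply: le_lt_trans (ltry C); exact/ell_norm_le.
have UE : U = EFin \o (fine \o U).
  apply/funext => k /=; rewrite fineK// ge0_fin_numE//.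
  exact: le_lt_trans (ell_norm_ge_term k q0 U0) h.
have u0 k : 0 <= (fine \o U) k by exact: fine_ge0.
exists (fine \o U), (fine (ell_norm q U)); split=> //.
  exact/fine_ge0/Lnorm_ge0.
apply/ell_norm_le => //; first exact/fine_ge0/Lnorm_ge0.
by rewrite -UE fineK// ge0_fin_numE ?Lnorm_ge0.
Qed.

Lemma ell_bound_term q u C k : (0 < q)%E -> (forall k, 0 <= u k) -> 0 <= C ->
  ell_bound q u C -> u k <= C.
Proof.
case: q => [r| |]//= q0 u0 C0.
move=> /(_ k.+1); rewrite big_ord_recr /= => h.
rewrite -(@ler_powR_base r)//; apply: le_trans h.
by rewrite lerDr sumr_ge0// => i _; exact: powR_ge0.
Qed.

Lemma le_ell_bound q u a C : (0 < q)%E -> (forall k, 0 <= u k <= a k) ->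
  ell_bound q a C -> ell_bound q u C.
Proof.
case: q => [r| |]//= q0 ua h; last first.
  by move=> k; have /andP[_ /le_trans] := ua k; apply.
move=> K; apply: le_trans (h K); apply: ler_sum => k _.
have /andP[u0 uak] := ua k.
by rewrite ler_powR_base// (le_trans u0).
Qed.

Lemma ell_boundZ q u C t : (0 < q)%E -> (forall k, 0 <= u k) -> 0 <= C -> 0 <= t ->
  ell_bound q u C -> ell_bound q (fun k => t * u k) (t * C).
Proof.
case: q => [r| |]//= q0 u0 C0 t0 h; last by move=> k; rewrite ler_wpM2l.
move=> K; under eq_bigr do rewrite powRM//.
by rewrite -mulr_sumr powRM// ler_wpM2l ?powR_ge0.
Qed.

Lemma ell_bound_delta q (k : nat) : (0 < q)%E ->
  ell_bound q (fun i : nat => (i == k)%:R) 1.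
Proof.
case: q => [r| |]//= r0; last by move=> i; rewrite lern1 leq_b1.
rewrite lte_fin in r0; move=> K; rewrite powR1.
have [kK|Kk] := ltnP k K.
  rewrite (bigD1 (Ordinal kK))//= big1 ?addr0 ?eqxx ?powR1// => i ik.
  have -> : (i == k :> nat) = false by exact/negbTE.
  by rewrite powR0 ?gt_eqF.
rewrite big1// => i _; rewrite ltn_eqF ?powR0 ?gt_eqF//.
exact: leq_trans Kk.
Qed.

Lemma ell_norm_le_bound q U a C : (0 < q)%E -> 0 <= C ->
    (forall k, 0 <= U k)%E -> (forall k, U k <= (a k)%:E)%E ->
  ell_bound q a C -> (ell_norm q U <= C%:E)%E.
Proof.
move=> q0 C0 U0 Ua aC.
have UE : U = EFin \o (fine \o U).
  apply/funext => k /=; rewrite fineK// ge0_fin_numE//.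
  exact: le_lt_trans (Ua k) (ltry _).
have u0 k : 0 <= (fine \o U) k by exact: fine_ge0.
rewrite UE; apply/ell_norm_le => //; apply: le_ell_bound aC => // k.
rewrite u0 -lee_fin; have := Ua k; rewrite {1}UE; exact.
Qed.

Lemma ell_bound_le_norm q U a C : (0 < q)%E -> 0 <= C ->
    (forall k, 0 <= a k) -> (forall k, (a k)%:E <= U k)%E ->
  (ell_norm q U <= C%:E)%E -> ell_bound q a C.
Proof.
move=> q0 C0 a0 aU UC.
have U0 k : (0 <= U k)%E by apply: le_trans (aU k); rewrite lee_fin.
have UE : U = EFin \o (fine \o U).
  apply/funext => k /=; rewrite fineK// ge0_fin_numE//.
  apply: le_lt_trans (ltry C); apply: le_trans UC; exact: ell_norm_ge_term.
move: UC; rewrite UE => /ell_norm_le; move=> /(_ q0).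
move=> H; apply: le_ell_bound (H _ C0) => // k; last exact: fine_ge0.
rewrite a0 -lee_fin; have := aU k; rewrite {1}UE; exact.
Qed.

(** The regimes that need different arguments: inclusion of sequence spaces, a bounded source, and a
    genuine Hoelder triple. In the last one [q2 < q1] is encoded by [0 < s]. *)
Variant qstar_spec (q1 q2 : \bar R) : \bar R -> Prop :=
| QstarInfty of (q1 <= q2)%E : qstar_spec q1 q2 +oo%E
| QstarTop (r : R) of q1 = +oo%E & q2 = r%:E & 0 < r : qstar_spec q1 q2 r%:E
| QstarFin (r1 r2 s : R) of q1 = r1%:E & q2 = r2%:E & 0 < r1 & 0 < r2 & 0 < s &
    r2^-1 = r1^-1 + s^-1 : qstar_spec q1 q2 s%:E.

Lemma qstarP (q1 q2 : \bar R) : (0 < q1)%E -> (0 < q2)%E ->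
  qstar_spec q1 q2 (qstar q1 q2).
Proof.
rewrite /qstar; case: q1 q2 => [r1| |] [r2| |]//; rewrite ?lte_fin => r10 r20.
- rewrite !inver !gt_eqF// -EFinB.
  have [r12|r21] := leP r1 r2.
    rewrite (_ : maxe _ _ = 0%E).
      by rewrite inve0; apply: QstarInfty; rewrite lee_fin.
    by apply/max_idPr; rewrite lee_fin subr_le0 lef_pV2.
  have B : 0 < r2^-1 - r1^-1 by rewrite subr_gt0 ltf_pV2.
  rewrite (_ : maxe _ _ = (r2^-1 - r1^-1)%:E); last first.
    by apply/max_idPl; rewrite lee_fin ltW.
  rewrite inver gt_eqF//; apply: (@QstarFin _ _ r1 r2) => //.
    by rewrite invr_gt0.
  by rewrite invrK addrC subrK.
- rewrite invey !inver gt_eqF// (_ : maxe _ _ = 0%E).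
    by rewrite inve0; apply: QstarInfty; exact: leey.
  by apply/max_idPr; rewrite sub0e leeNl oppe0 lee_fin invr_ge0 ltW.
- rewrite invey !inver gt_eqF// sube0 (_ : maxe _ _ = r2^-1%:E).
    by rewrite inver invr_eq0 gt_eqF// invrK; exact: QstarTop.
  by apply/max_idPl; rewrite lee_fin invr_ge0 ltW.
- by rewrite invey sube0 maxxx inve0; apply: QstarInfty.
Qed.

Lemma qstar_gt0 (q1 q2 : \bar R) : (0 < q1)%E -> (0 < q2)%E ->
  (0 < qstar q1 q2)%E.
Proof. by move=> q10 q20; case: (qstarP q10 q20). Qed.

(** Hoelder's inequality for multipliers. [D] is kept positive, even for [C = 0], because radii are
    later divided by it. *)
Lemma ell_boundM (q1 q2 : \bar R) b C :
    (0 < q1)%E -> (0 < q2)%E -> (forall k, 0 <= b k) -> 0 <= C ->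
    ell_bound (qstar q1 q2) b C ->
  exists2 D, 0 < D & forall a r, (forall k, 0 <= a k) -> 0 < r ->
    ell_bound q1 a r -> ell_bound q2 (fun k => b k * a k) (r * D).
Proof.
move=> q10 q20 b0 C0 bC.
(* By homogeneity the unit ball suffices: the general case follows by applying this to
   [r^-1 * a]. *)
suff [D D0 H] : exists2 D, 0 < D & forall a, (forall k, 0 <= a k) ->
    ell_bound q1 a 1 -> ell_bound q2 (fun k => b k * a k) D.
  exists D => // a r a0 r0 ar.
  have := @ell_boundZ q1 a r r^-1 q10 a0 (ltW r0) _ ar.
  rewrite invr_ge0 mulVf ?gt_eqF// => /(_ (ltW r0)).
  move=> /H - /(_ (fun k => mulr_ge0 (ltW (etrans (invr_gt0 r) r0)) (a0 k))).
  move=> /(@ell_boundZ _ _ _ r q20) /=.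
  have ba0 k : 0 <= b k * (r^-1 * a k) by rewrite !mulr_ge0// invr_ge0 ltW.
  move=> /(_ ba0 (ltW D0) (ltW r0)); apply: le_ell_bound => // k.
  by rewrite mulr_ge0//= mulrCA mulVKf ?gt_eqF.
case: (qstarP q10 q20) bC => [q12|r q1E q2E r0|r1 r2 s q1E q2E r10 r20 s0 rE] /= bC.
- exists (C + 1); first by rewrite ltr_wpDl.
  move=> a a0 a1.
  have a_le1 k : a k <= 1 by apply: (@ell_bound_term q1).
  suff a21 : ell_bound q2 a 1.
    have := @ell_boundZ q2 a 1 (C + 1) q20 a0 ler01 _ a21.
    rewrite mulr1 => /(_ (addr_ge0 C0 ler01)); apply: le_ell_bound => // k.
    by rewrite mulr_ge0//= ler_wpM2r// (le_trans (bC k)) ?lerDl.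
  case: q2 q20 q12 => [r2| |]//.
  case: q1 q10 a1 => [r1| |]//; rewrite !lte_fin lee_fin => r10 /= a1 r20 r12 K.
  apply: le_trans (le_trans (a1 K) _); last by rewrite !powR1.
  apply: ler_sum => k _; have [->|ak0] := eqVneq (a k) 0.
    by rewrite !powR0 ?gt_eqF.
  by apply: ger_powR => //; rewrite lt_def ak0 a0 a_le1.
- exists (C + 1); first by rewrite ltr_wpDl.
  move=> a a0; rewrite q1E q2E /= => a1 K.
  apply: le_trans (le_trans (bC K) _).
    apply: ler_sum => k _; rewrite ler_powR_base ?mulr_ge0//.
    by rewrite ler_piMr.
  by rewrite ler_powR_base ?addr_ge0// lerDl.
(* Since 1/r2 = 1/r1 + 1/s, b x <= max(x^r1, b^s)^(1/r2) pointwise, which replaces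
   Hoelder's inequality for exponents possibly below 1. *)
- exists ((1 + C `^ s) `^ r2^-1).
    by rewrite powR_gt0// ltr_pwDl// powR_ge0.
  move=> a a0; rewrite q1E q2E /= powR1 => a1 K.
  rewrite -powRrM mulVf ?gt_eqF// powRr1 ?addr_ge0 ?powR_ge0//.
  apply: le_trans _ (lerD (a1 K) (bC K)).
  rewrite -big_split /=; apply: ler_sum => k _.
  set x := a k `^ r1; set y := b k `^ s.
  have x0 : 0 <= x by exact: powR_ge0.
  have y0 : 0 <= y by exact: powR_ge0.
  pose m : R := Num.max x y.
  have m0 : 0 <= m by rewrite le_max x0.
  have aE : a k = x `^ r1^-1 by rewrite -powRrM mulfV ?gt_eqF// powRr1.
  have bE : b k = y `^ s^-1 by rewrite -powRrM mulfV ?gt_eqF// powRr1.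
  apply: (@le_trans _ _ m); last by rewrite ge_max lerDl lerDr x0 y0.
  rewrite -[leRHS]powRr1// -(mulVf (lt0r_neq0 r20)) powRrM.
  rewrite ler_powR_base ?mulr_ge0 ?powR_ge0// rE powRD; last first.
    by rewrite gt_eqF// addr_gt0 ?invr_gt0.
  rewrite aE bE mulrC ler_pM ?powR_ge0//.
    by rewrite ler_powR_base ?invr_gt0// le_max lexx.
  by rewrite ler_powR_base ?invr_gt0// le_max lexx orbT.
Qed.

(** Each regime has its own test sequence: unit vectors if [q1 <= q2], the constant 1 if [q1 = +oo],
    and otherwise the sequence attaining equality in Hoelder's inequality. No constant is lost. *)
Lemma ell_bound_dual (q1 q2 : \bar R) b D :
    (0 < q1)%E -> (0 < q2)%E -> (forall k, 0 <= b k) -> 0 <= D ->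
    (forall a, (forall k, 0 <= a k) -> ell_bound q1 a 1 ->
      ell_bound q2 (fun k => b k * a k) D) ->
  ell_bound (qstar q1 q2) b D.
Proof.
move=> q10 q20 b0 D0 H.
case: (qstarP q10 q20) => [q12|r q1E q2E r0|r1 r2 s q1E q2E r10 r20 s0 rE] /=.
- move=> k; have := H _ (fun i => ler0n _ _) (ell_bound_delta k q10).
  move=> /(@ell_bound_term _ _ _ k q20); rewrite eqxx mulr1; apply => // i.
  by rewrite mulr_ge0.
- move: H; rewrite q1E q2E /= => /(_ (fun=> 1)).
  by move=> /(_ (fun=> ler01) (fun=> lexx _)) h K; under eq_bigr do rewrite -[b _]mulr1.
- move=> K; set S := \sum_(_ < _) _.
  have S0 : 0 <= S by rewrite sumr_ge0// => i _; exact: powR_ge0.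
  have [->|SN0] := eqVneq S 0; first exact: powR_ge0.
  have Sgt0 : 0 < S by rewrite lt_def SN0.
  (* The equality case of Hoelder's inequality, truncated. *)
  pose a k : R := if (k < K)%N then (b k `^ s / S) `^ r1^-1 else 0.
  have bS0 k : 0 <= b k `^ s / S by rewrite divr_ge0// powR_ge0.
  have a0 k : 0 <= a k by rewrite /a; case: ifP => // _; exact: powR_ge0.
  (* A nonnegative sequence vanishing from [K] on has all its partial sums bounded by the [K]-th
     one; this applies to the truncated [a]. *)
  have sum_trunc (F : nat -> R) K' : (forall k, 0 <= F k) ->
      (forall k, (K <= k)%N -> F k = 0) -> \sum_(k < K') F k <= \sum_(k < K) F k.
    move=> F0 FK; rewrite -!(big_mkord xpredT F).
    have [KK'|/ltnW K'K] := leqP K K'.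
      rewrite (big_cat_nat (n := K))//= [X in _ + X]big_nat_cond [X in _ + X]big1 ?addr0//.
      by move=> i /andP[/andP[/FK]].
    by rewrite [leRHS](big_cat_nat (n := K'))//= lerDl sumr_ge0.
  have : ell_bound q1 a 1.
    rewrite q1E /= => K'; rewrite powR1.
    apply: le_trans (sum_trunc (fun k => a k `^ r1) K' _ _) _ => [k|k Kk|].
    - exact: powR_ge0.
    - by rewrite /a ltnNge Kk /= powR0// gt_eqF.
    rewrite (eq_bigr (fun k : 'I_K => b k `^ s / S)) => [|k _]; last first.
      by rewrite /a ltn_ord -powRrM mulVf ?gt_eqF// powRr1.
    by rewrite -mulr_suml mulfV.
  move=> /(H _ a0); rewrite q2E /= => /(_ K).
  rewrite (eq_bigr (fun k : 'I_K => b k `^ s * S `^ (- (r2 / r1)))) => [|k _]; last first.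
    rewrite /a ltn_ord powRM ?powR_ge0// -powRrM powRM ?invr_ge0 ?powR_ge0//.
    have -> : S^-1 `^ (r1^-1 * r2) = S `^ (- (r2 / r1)).
      by rewrite powRN mulrC -[S^-1]powR_inv1// -powRrM mulN1r powRN.
    rewrite mulrA -powRrM -powRD.
      have -> // : r2 + s * (r1^-1 * r2) = s.
      apply: (mulfI (invr_neq0 (lt0r_neq0 r20))).
      by rewrite mulrDr mulVf ?gt_eqF// [in RHS]rE; field; rewrite !gt_eqF.
    apply/implyP; rewrite gt_eqF// addr_gt0// !mulr_gt0// invr_gt0//.
  rewrite -mulr_suml -/S -{1}(powRr1 S0) -powRD ?SN0 ?implybT//.
  have -> : 1 - r2 / r1 = r2 / s.
    by rewrite -(mulfV (lt0r_neq0 r20)) rE; ring.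
  rewrite mulrC powRrM ler_powR_base ?powR_ge0// => h.
  rewrite -(powRr1 S0) -(mulVf (lt0r_neq0 s0)) powRrM.
  by rewrite ler_powR_base ?powR_ge0.
Qed.

End weighted_sequences.

(** * Dyadic averages and the Morrey norm of step functions *)

Section dyadic_averages.
Context {R : realType}.

Lemma side_gt0 (j : int) : 0 < side j :> R.
Proof. by rewrite /side exprz_gt0. Qed.

Lemma side_succ (j : int) : side (j + 1) = side j / 2 :> R.
Proof. by rewrite /side opprD exprzDr ?unitfE// expN1r. Qed.

Context {d : nat}.
Implicit Types (k : d.-tuple int) (e : d.-tuple bool) (x : d.-tuple R).
Implicit Type g : d.-tuple int -> R.

Definition cube_at (j : int) x : d.-tuple int :=
  [tuple Num.floor (tnth x i / side j) | i < d].

Definition child k e : d.-tuple int :=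
  [tuple 2 * tnth k i + (tnth e i : nat)%:Z | i < d].

Definition parent k : d.-tuple int := [tuple (tnth k i %/ 2)%Z | i < d].

Definition parity k : d.-tuple bool := [tuple (tnth k i %% 2)%Z == 1 | i < d].

Lemma child_parentK k : child (parent k) (parity k) = k.
Proof.
apply: eq_from_tnth => i; rewrite !tnth_mktuple.
have := modz_ge0 (tnth k i) (isT : 2%:Z != 0).
have := ltz_pmod (tnth k i) (isT : 0 < 2%:Z).
have := divz_eq (tnth k i) 2.
by case: eqP => /=; lia.
Qed.

Lemma parent_childK k e : parent (child k e) = k.
Proof.
apply: eq_from_tnth => i; rewrite !tnth_mktuple.
by case: (tnth e i) => /=; lia.
Qed.

Lemma parity_childK k e : parity (child k e) = e.
Proof.
apply: eq_from_tnth => i; rewrite !tnth_mktuple.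
by case: (tnth e i) => /=; apply/eqP; lia.
Qed.

Lemma eq_child k e k' : (child k e == k') = (k == parent k') && (e == parity k').
Proof.
apply/eqP/andP => [<-|[/eqP-> /eqP->]]; last exact: child_parentK.
by rewrite parent_childK parity_childK.
Qed.

(** Cubes of one level are the fibres of a map, which makes their disjointness and the constancy of
    step functions on them immediate. *)
Lemma dyadic_cubeE (j : int) k : dyadic_cube j k = [set x | cube_at j x = k].
Proof.
have s0 := side_gt0 j.
have h x i : (side j * (tnth k i)%:~R <= tnth x i < side j * ((tnth k i)%:~R + 1)) =
    (Num.floor (tnth x i / side j) == tnth k i).
  rewrite -[1]/(1%:~R) -rmorphD /= ![side j * _]mulrC.
  rewrite -ler_pdivlMr// -ltr_pdivrMr//.
  by apply/idP/eqP => [/floor_def//|<-]; exact: floor_itv.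
apply/seteqP; split => x /= H.
  by apply: eq_from_tnth => i; rewrite tnth_mktuple; apply/eqP; rewrite -h; exact: H.
by move=> i; rewrite h -H tnth_mktuple.
Qed.

(** Coordinatewise, the floor of [y] is the integer half of the floor of [2 * y]. *)
Lemma parent_cube_at (j : int) x : parent (cube_at (j + 1) x) = cube_at j x.
Proof.
apply: eq_from_tnth => i; rewrite !tnth_mktuple side_succ.
set y := tnth x i / side j.
have -> : tnth x i / (side j / 2) = 2 * y.
  by rewrite invf_div mulrCA.
apply/esym/floor_def.
have /andP[] := floor_itv (2 * y); set f := Num.floor (2 * y) => f1 f2.
have fE := divz_eq f 2.
have m0 := modz_ge0 f (isT : 2%:Z != 0).
have m1 := ltz_pmod f (isT : 0 < 2%:Z).
have a1 : 2 * (f %/ 2)%Z <= f by lia.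
have a2 : f + 1 <= 2 * ((f %/ 2)%Z + 1) by lia.
move: a1 a2; rewrite -(ler_int R) -(ler_int R) !rmorphM /= => a1 a2.
by apply/andP; split; lra.
Qed.

Lemma measurable_dyadic_cube (j : int) k :
  measurable (dyadic_cube j k : set (d.-tuple R)).
Proof.
rewrite (_ : dyadic_cube j k = \bigcap_(i in [set: 'I_d])
    ((fun x : d.-tuple R => tnth x i) @^-1`
      `[side j * (tnth k i)%:~R, side j * ((tnth k i)%:~R + 1)[%classic)).
  apply: fin_bigcap_measurable; first exact: finite_finset.
  move=> i _; rewrite -[X in measurable X]setTI.
  by apply: measurable_tnth => //; exact: measurable_itv.
rewrite predeqE => x; split => [Bx i _|Bx i].
  by rewrite /= in_itv /=; exact: Bx.
by have := Bx i I; rewrite /= in_itv.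
Qed.

Lemma lebesgue_dyadic_cube (j : int) k :
  lebesgue_tuple d (dyadic_cube j k) = ((side j : R) ^+ d)%:E.
Proof.
pose a := [tuple (side j * (tnth k i)%:~R : R) | i < d].
pose b := [tuple (side j * ((tnth k i)%:~R + 1) : R) | i < d].
have ab (i : 'I_d) : tnth a i <= tnth b i.
  by rewrite !tnth_mktuple ler_wpM2l ?lerDl// ltW// side_gt0.
rewrite (_ : dyadic_cube j k =
    [set x | forall i, tnth a i <= tnth x i < tnth b i]); last first.
  apply/seteqP; split => x /= + i; move=> /(_ i); rewrite !tnth_mktuple//.
rewrite lebesgue_tuple_box// (eq_bigr (fun=> side j)) => [|i _].
  by rewrite prodr_const card_ord.
by rewrite !tnth_mktuple -mulrBr addrAC subrr add0r mulr1.
Qed.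

Lemma integral_cst_dyadic_cube (j : int) k (r : R) :
  (\int[lebesgue_tuple d]_(x in dyadic_cube j k) (cst r%:E) x =
   (r * side j ^+ d)%:E)%E.
Proof.
rewrite integral_cst; last exact: measurable_dyadic_cube.
exact: (congr1 (mule r%:E) (lebesgue_dyadic_cube j k)).
Qed.

Lemma measurable_cube_at (j : int) (g : d.-tuple int -> R) :
  measurable_fun setT (fun x => (g (cube_at j x))%:E).
Proof.
move=> _ B mB; rewrite setTI.
rewrite (_ : _ @^-1` B = \bigcup_k
    (if (g k)%:E \in B then dyadic_cube j k else set0)).
  apply: countable_bigcupT_measurable => [|k]; first exact: countableP.
  by case: ifP => _ //; exact: measurable_dyadic_cube.
apply/seteqP; split => [x /= Bx|x /= [k _]].
  by exists (cube_at j x) => //; rewrite mem_set// dyadic_cubeE.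
by case: ifPn => [/set_mem Bk|//]; rewrite dyadic_cubeE /= => ->.
Qed.

Lemma dyadic_cube_children (j : int) k :
  dyadic_cube j k =
  \big[setU/set0]_(e <- enum {: d.-tuple bool}) dyadic_cube (j + 1) (child k e)
    :> set (d.-tuple R).
Proof.
rewrite -bigcup_seq; apply/seteqP; split => [x|x [e _]]; rewrite !dyadic_cubeE /=.
  move=> xk; exists (parity (cube_at (j + 1) x)); first by rewrite /= mem_enum.
  by rewrite dyadic_cubeE /= -[LHS]child_parentK parent_cube_at xk.
by move=> xe; rewrite -parent_cube_at xe parent_childK.
Qed.

(** If [g] lists values on cubes of level [j], this is the mean over cube [k] of level [j - n]. The
    level [j] itself does not enter, so means are studied without measure theory. *)
Fixpoint dyadic_mean (g : d.-tuple int -> R) (n : nat) (k : d.-tuple int) : R :=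
  if n is n'.+1 then
    (2 ^+ d)^-1 * \sum_(e : d.-tuple bool) dyadic_mean g n' (child k e)
  else g k.

Lemma dyadic_mean_ge0 g n k : (forall m, 0 <= g m) -> 0 <= dyadic_mean g n k.
Proof.
move=> g0; elim: n k => [|n IH] k //=.
by rewrite mulr_ge0 ?invr_ge0 ?exprn_ge0// sumr_ge0.
Qed.

(** By induction over the decomposition into children; halving the side produces the factor
    [(2 ^+ d)^-1] of the recursion. *)
Lemma integral_dyadic_mean (j : int) g n k : (forall m, 0 <= g m) ->
  (\int[lebesgue_tuple d]_(x in dyadic_cube (j - n%:Z) k) (g (cube_at j x))%:E =
   (dyadic_mean g n k * side (j - n%:Z) ^+ d)%:E)%E.
Proof.
move=> g0; elim: n k => [|n IH] k.
  rewrite subr0 /= (eq_integral (cst (g k)%:E)) => [|x]; last first.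
    by rewrite dyadic_cubeE inE /= => ->.
  exact: integral_cst_dyadic_cube.
have jn : j - n%:Z = j - n.+1%:Z + 1 by lia.
rewrite dyadic_cube_children ge0_integral_bigsetU//=.
- rewrite -jn; under eq_bigr do rewrite IH.
  rewrite sumEFin big_enum /= -mulr_suml jn side_succ expr_div_n.
  by congr (_%:E); ring.
- by move=> e; exact: measurable_dyadic_cube.
- exact: enum_uniq.
- move=> e e' _ _ [x []]; rewrite !dyadic_cubeE /= => -> /(congr1 parity).
  by rewrite !parity_childK.
- apply/measurable_funTS; exact: measurable_cube_at.
- by move=> x _; rewrite lee_fin.
Qed.

Lemma integral_fine_cube (j : int) g n k :
  (\int[lebesgue_tuple d]_(x in dyadic_cube (j + n%:Z) k) (g (cube_at j x))%:E =
   (g (iter n parent k) * side (j + n%:Z) ^+ d)%:E)%E.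
Proof.
rewrite (eq_integral (cst (g (iter n parent k))%:E)) => [|x]; last first.
  rewrite dyadic_cubeE inE /= => <-; congr (g _)%:E.
  elim: n => [|n IH]; first by rewrite addr0.
  by rewrite iterSr -[in parent _]addn1 PoszD addrA parent_cube_at.
exact: integral_cst_dyadic_cube.
Qed.

Lemma step_funE (c : d.-tuple int -> R[i]) (j : nat) x :
  step_fun c j x = c (cube_at j x).
Proof.
rewrite /step_fun -(@fsbig_widen _ _ _ _ [set cube_at j x])//.
  by rewrite fsbig_set1 indicE dyadic_cubeE mem_set// mulr1.
move=> m [_ /= xm]; rewrite indicE dyadic_cubeE memNset ?mulr0//= => h.
exact/xm/esym.
Qed.

(** * Morrey norms of step functions through dyadic means *)

Section morrey.
Context {phi : R -> R} (p : R).
Hypothesis p_gt0 : 0 < p.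
Hypothesis phi_gt0 : forall t : R, 0 < t -> 0 < phi t.
Hypothesis phi_nd : forall t r : R, 0 < t -> t <= r -> phi t <= phi r.
Implicit Type c : d.-tuple int -> R[i].

Definition abs_pow c : d.-tuple int -> R := fun m => Normc.normc (c m) `^ p.

Lemma abs_pow_ge0 c m : 0 <= abs_pow c m.
Proof. exact: powR_ge0. Qed.

(** One term of the supremum, once the mean value [v] over the cube is known; it serves cubes both
    coarser and finer than level [j]. *)
Lemma morrey_term c (j : nat) (i : int) k (v : R) : 0 <= v ->
  (\int[lebesgue_tuple d]_(x in dyadic_cube i k) (abs_pow c (cube_at j x))%:E =
    (v * side i ^+ d)%:E)%E ->
  ((phi (side i))%:E * ((lebesgue_tuple d (dyadic_cube i k))^-1 *
     \int[lebesgue_tuple d]_(x in dyadic_cube i k)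
       (Normc.normc (step_fun c j x) `^ p)%:E) `^ p^-1)%E =
  (phi (side i) * v `^ p^-1)%:E.
Proof.
move=> v0 I; under eq_integral do rewrite step_funE -/(abs_pow c _).
rewrite I lebesgue_dyadic_cube inver gt_eqF ?exprn_gt0 ?side_gt0//.
rewrite [RHS]EFinM -poweR_EFin; congr (_ * _ `^ _)%E.
by rewrite -EFinM mulrCA mulVf ?mulr1// gt_eqF ?exprn_gt0 ?side_gt0.
Qed.

Lemma morrey_norm_ge c (j n : nat) k :
  ((phi (side (j%:Z - n%:Z)) * dyadic_mean (abs_pow c) n k `^ p^-1)%:E <=
   morrey_norm phi p (step_fun c j))%E.
Proof.
apply: ereal_sup_ubound; exists (j%:Z - n%:Z, k) => //=.
apply: morrey_term; first exact/dyadic_mean_ge0/abs_pow_ge0.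
exact/integral_dyadic_mean/abs_pow_ge0.
Qed.

(** On a cube finer than level [j] the function equals its coefficient on the ancestor of level [j],
    and [phi] is no larger there; so the ancestor's term dominates. *)
Lemma morrey_norm_le c (j : nat) (C : R) :
  (forall n k, phi (side (j%:Z - n%:Z)) * dyadic_mean (abs_pow c) n k `^ p^-1 <= C) ->
  (morrey_norm phi p (step_fun c j) <= C%:E)%E.
Proof.
move=> H; apply: ge_ereal_sup => _ [[i k] _ <-] /=.
have [ij|/ltW ji] := leP i j%:Z.
  have -> : i = j%:Z - `|j%:Z - i|%N%:Z by lia.
  rewrite (@morrey_term _ _ _ _ (dyadic_mean (abs_pow c) `|j%:Z - i|%N k))//.
  - by rewrite lee_fin.
  - exact/dyadic_mean_ge0/abs_pow_ge0.
  - exact/integral_dyadic_mean/abs_pow_ge0.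
have -> : i = j%:Z + `|i - j%:Z|%N%:Z by lia.
set n := `|_|%N.
rewrite (@morrey_term _ _ _ _ (abs_pow c (iter n parent k))); last 2 first.
- exact: abs_pow_ge0.
- exact: integral_fine_cube.
rewrite lee_fin; apply: le_trans (H 0%N (iter n parent k)).
rewrite subr0 /= ler_wpM2r ?powR_ge0// phi_nd ?side_gt0//.
rewrite /side opprD exprzDr ?unitfE// ler_piMr ?exprz_ge0//.
by rewrite -exprnN invf_le1 ?exprn_gt0// exprn_ege1// ler1n.
Qed.

Lemma morrey_norm_ge0 c (j : nat) : (0 <= morrey_norm phi p (step_fun c j))%E.
Proof.
apply: le_trans (morrey_norm_ge c j 0 [tuple 0 | _ < d]).
by rewrite lee_fin mulr_ge0 ?powR_ge0// ltW// phi_gt0// side_gt0.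
Qed.

End morrey.
End dyadic_averages.

(** * Comparison at one level *)

Section level_comparison.
Context {R : realType} {d : nat}.
Implicit Types (g h : d.-tuple int -> R) (c : d.-tuple int -> R[i]).

Lemma normc_ge0 (z : R[i]) : 0 <= Normc.normc z.
Proof. by case: z => a b; exact: sqrtr_ge0. Qed.

Lemma dyadic_mean_affine (a b : R) g h n k : (forall m, g m <= a * h m + b) ->
  dyadic_mean g n k <= a * dyadic_mean h n k + b.
Proof.
move=> gh; elim: n k => [|n IH] k //=.
apply: (@le_trans _ _ ((2 ^+ d)^-1 *
    \sum_(e : d.-tuple bool) (a * dyadic_mean h n (child k e) + b))).
  by rewrite ler_wpM2l ?invr_ge0 ?exprn_ge0//; exact: ler_sum.
rewrite big_split /= sumr_const card_tuple card_bool -mulr_sumr mulrDr mulrCA.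
by rewrite -[b *+ _]mulr_natl natrX mulKf// expf_neq0.
Qed.

Lemma young_powR (t y s : R) : 0 < t <= 1 -> 0 <= y -> 0 <= s ->
  y `^ t * s `^ (1 - t) <= t * y + (1 - t) * s.
Proof.
move=> /andP[t0 t1] y0 s0; have [->|tN1] := eqVneq t 1.
  by rewrite subrr powRr0 powRr1// mul0r addr0 mulr1 mul1r.
have u0 : 0 < 1 - t by rewrite subr_gt0 lt_neqAle tN1.
have := @conjugate_powR _ (y `^ t) (s `^ (1 - t)) t^-1 (1 - t)^-1
  (powR_ge0 _ _) (powR_ge0 _ _).
rewrite !invr_gt0 !invrK -!powRrM !mulfV ?gt_eqF// !powRr1//.
by rewrite (mulrC y) (mulrC s); apply; rewrite // addrC subrK.
Qed.

(** Jensen's inequality for a concave power: [young_powR] bounds the power by its tangent line at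
    [s], and affine bounds pass to means. *)
Lemma dyadic_mean_powR (t s : R) g n k : 0 < t <= 1 -> (forall m, 0 <= g m) ->
  0 < s -> dyadic_mean g n k <= s ->
  dyadic_mean (fun m => g m `^ t) n k <= s `^ t.
Proof.
move=> t01 g0 s0 gs; have /andP[t0 t1] := t01.
pose w := s `^ (1 - t); have w0 : 0 < w by exact: powR_gt0.
have ws : s `^ t * w = s.
  by rewrite -powRD addrC ?subrK ?oner_eq0// powRr1// ltW.
have H : dyadic_mean (fun m => g m `^ t) n k <=
    t / w * dyadic_mean g n k + (1 - t) * s / w.
  apply: dyadic_mean_affine => m; rewrite mulrAC -mulrDl ler_pdivlMr//.
  by apply: young_powR => //; exact: ltW.
rewrite -(ler_pM2r w0) ws; move: H.
rewrite mulrAC -mulrDl ler_pdivlMr// => /le_trans; apply.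
by rewrite mulrBl mul1r addrCA gerDl subr_le0 ler_wpM2l// ltW.
Qed.

Context {p1 p2 : R} {phi1 phi2 : R -> R}.
Hypotheses (p1_gt0 : 0 < p1) (p2_gt0 : 0 < p2).
Hypothesis phi1_gt0 : forall t : R, 0 < t -> 0 < phi1 t.
Hypothesis phi2_gt0 : forall t : R, 0 < t -> 0 < phi2 t.
Let rho := Num.min 1 (p1 / p2).

Lemma dyadic_mean_comparison (c : d.-tuple int -> R[i]) (j : int) (A K : R) :
    0 < A ->
    (forall n k, phi1 (side (j - n%:Z)) *
       dyadic_mean (abs_pow p1 c) n k `^ p1^-1 <= A) ->
    (forall n : nat, phi2 (side (j - n%:Z)) <= K * phi1 (side (j - n%:Z)) `^ rho) ->
  forall n k, phi2 (side (j - n%:Z)) * dyadic_mean (abs_pow p2 c) n k `^ p2^-1 <=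
    K * (phi1 (side j) `^ rho / phi1 (side j)) * A.
Proof.
move=> A0 H1 HK n k.
have f0 i : 0 < phi1 (side i) by rewrite phi1_gt0 ?side_gt0.
have Af0 i : 0 <= A / phi1 (side i) by rewrite divr_ge0 ?ltW.
have M1 i k' : dyadic_mean (abs_pow p1 c) i k' <= (A / phi1 (side (j - i%:Z))) `^ p1.
  have m0 : 0 <= dyadic_mean (abs_pow p1 c) i k'.
    exact/dyadic_mean_ge0/abs_pow_ge0.
  rewrite -(@ler_powR_base _ p1^-1) ?invr_gt0 ?powR_ge0//.
  by rewrite -[leRHS]powRrM mulfV ?gt_eqF// powRr1 ?Af0// ler_pdivlMr// mulrC.
set fn := phi1 (side (j - n%:Z)); have fn0 : 0 < fn by exact: f0.
set fj := phi1 (side j); have fj0 : 0 < fj by exact: f0.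
suff M2 : dyadic_mean (abs_pow p2 c) n k <=
    ((fj `^ rho / fj) * A * (fn `^ rho)^-1) `^ p2.
  have m0 : 0 <= dyadic_mean (abs_pow p2 c) n k.
    exact/dyadic_mean_ge0/abs_pow_ge0.
  move: M2; rewrite -(@ler_powR_base _ p2^-1) ?invr_gt0 ?powR_ge0//.
  rewrite -[leRHS]powRrM mulfV ?gt_eqF// powRr1; last first.
    by rewrite mulr_ge0 ?invr_ge0 ?powR_ge0// mulr_ge0 ?divr_ge0 ?powR_ge0 ?ltW.
  move=> M2; apply: le_trans (ler_pM _ _ (HK n) M2) _.
  - by rewrite ltW// phi2_gt0// side_gt0.
  - exact: powR_ge0.
  have fr0 : fn `^ rho != 0 by rewrite gt_eqF// powR_gt0.
  by rewrite -/fn le_eqVlt; apply/orP; left; apply/eqP; field; rewrite fr0 gt_eqF.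
rewrite /rho; have [p21|p12] := leP 1 (p1 / p2).
  (* Here [rho = 1] and [p2 <= p1], so Jensen with exponent [p2 / p1] turns [M1] into the claim. *)
  rewrite !powRr1 ?(ltW fn0) ?(ltW fj0)// divff ?gt_eqF// mul1r.
  have p2p1 : p2 <= p1 by move: p21; rewrite ler_pdivlMr// mul1r.
  have -> : abs_pow p2 c = fun m => abs_pow p1 c m `^ (p2 / p1).
    by apply/funext => m; rewrite /abs_pow -powRrM mulrCA mulfV ?mulr1 ?gt_eqF.
  have -> : (A / fn) `^ p2 = ((A / fn) `^ p1) `^ (p2 / p1).
    by rewrite -powRrM mulrCA mulfV ?mulr1 ?gt_eqF.
  apply: dyadic_mean_powR => //.
  - by rewrite divr_gt0//= ler_pdivrMr// mul1r.
  - by move=> m; exact: powR_ge0.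
  - by rewrite powR_gt0// divr_gt0.
have p12' : p1 < p2 by move: p12; rewrite ltr_pdivrMr// mul1r.
(* At [n = 0] a mean is a single coefficient. This pointwise bound absorbs the surplus power
   [p2 - p1], leaving a mean of exponent [p1]. *)
have cA m : Normc.normc (c m) <= A / fj.
  by have := M1 0%N m; rewrite subr0 /= /abs_pow ler_powR_base ?normc_ge0 ?Af0.
have := @dyadic_mean_affine ((A / fj) `^ (p2 - p1)) 0 (abs_pow p2 c) (abs_pow p1 c) n k.
rewrite addr0 => H; apply: le_trans (H _) _ => [m|].
  rewrite addr0 /abs_pow; have [->|c0] := eqVneq (Normc.normc (c m)) 0.
    by rewrite !powR0 ?mulr0// gt_eqF.
  have -> : Normc.normc (c m) `^ p2 =
      Normc.normc (c m) `^ (p2 - p1) * Normc.normc (c m) `^ p1.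
    by rewrite -powRD ?subrK// c0 implybT.
  by rewrite ler_wpM2r ?powR_ge0// ler_powR_base ?subr_gt0 ?Af0 ?normc_ge0.
apply: (@le_trans _ _ ((A / fj) `^ (p2 - p1) * (A / fn) `^ p1)).
  by rewrite ler_wpM2l ?powR_ge0.
rewrite le_eqVlt; apply/orP; left; apply/eqP.
have rp : p1 / p2 * p2 = p1 by rewrite divfK ?gt_eqF.
have fj' : fj^-1 = fj `^ (-1) by rewrite powR_inv1 ?ltW.
rewrite -!powRN fj' !powRM ?mulr_ge0 ?powR_ge0 ?invr_ge0 ?ltW//.
rewrite -[fn^-1]powR_inv1 ?(ltW fn0)// -!powRrM !mulN1r mulNr rp.
have -> : A `^ p2 = A `^ (p2 - p1) * A `^ p1.
  by rewrite -powRD ?subrK// (gt_eqF A0) implybT.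
have -> : fj `^ (- (p2 - p1)) = fj `^ p1 * fj `^ (- p2).
  by rewrite -powRD ?opprB// (gt_eqF fj0) implybT.
by ring.
Qed.

End level_comparison.

(** * Cantor sets and extremal functions *)

Section cantor_sets.
Context {R : realType} {d : nat}.
Implicit Types (k : d.-tuple int) (e : d.-tuple bool) (g : d.-tuple int -> R).

Lemma dyadic_meanZ (a : R) g n k :
  dyadic_mean (fun m => a * g m) n k = a * dyadic_mean g n k.
Proof.
by elim: n k => [|n IH] k //=; under eq_bigr do rewrite IH; rewrite -mulr_sumr mulrCA.
Qed.

(** If passing to a child multiplies [F] by a weight depending only on the level and the child's
    position, the mean picks up the average weight of each level. Cantor sets and single cubes are
    both of this kind. *)
Lemma dyadic_mean_product (F : nat -> d.-tuple int -> R)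
    (w : nat -> d.-tuple bool -> R) (v : nat -> R) :
    v 0%N = 1 -> (forall n, v n.+1 = v n * ((2 ^+ d)^-1 * \sum_e w n e)) ->
    (forall n k e, F n (child k e) = F n.+1 k * w n e) ->
  forall n k, dyadic_mean (F 0%N) n k = F n k * v n.
Proof.
move=> v0 vS FS; elim=> [|n IH] k /=; first by rewrite v0 mulr1.
under eq_bigr do rewrite IH FS.
rewrite vS (eq_bigr (fun e => F n.+1 k * v n * w n e)) => [|e _]; last by ring.
by rewrite -mulr_sumr; ring.
Qed.

(* The cubes of level [j - n] meeting the Cantor set are those all of whose
   coordinates are nonnegative with bit [i] unset whenever [b (n + i)] is false. *)
Definition allowed (b : nat -> bool) (n : nat) (z : int) : bool :=
  `[< 0 <= z /\ forall i, odd (`|z|%N %/ 2 ^ i) -> b (n + i)%N >].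

Lemma allowed0 b n : allowed b n 0.
Proof. by apply/asboolP; split => // i; rewrite div0n. Qed.

(** Passing to a child appends [e] as lowest binary digit and shifts the others up by one. *)
Lemma allowed_child b n (z : int) (e : bool) :
  allowed b n (2 * z + (e : nat)%:Z) = allowed b n.+1 z && (e ==> b n).
Proof.
have S (z' : int) i : 0 <= z' ->
    (`|(2 * z' + (e : nat)%:Z)%R|%N %/ 2 ^ i.+1 = `|z'|%N %/ 2 ^ i)%N.
  move=> z0; rewrite expnS divnMA; congr (_ %/ _)%N.
  by case: e => /=; lia.
have O (z' : int) : 0 <= z' -> odd `|(2 * z' + (e : nat)%:Z)%R|%N = e.
  by move=> z0; case: (e) => /=; lia.
apply/asboolP/andP => [[z0 H]|[/asboolP[z0 H] eb]].
  have z0' : 0 <= z by case: (e) z0 => /=; lia.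
  split; first (apply/asboolP; split => // i).
    by rewrite -S// => /H; rewrite addnS.
  by apply/implyP => eT; have := H 0%N; rewrite expn0 divn1 O// addn0; exact.
split; first by case: (e) => /=; lia.
case=> [|i]; first by rewrite expn0 divn1 O// addn0; exact/implyP.
by rewrite S// => /H; rewrite addnS.
Qed.

Section greedy.
Variables (h : nat -> R) (J : nat).

(* Density of the set in a cube of level [j - n] that meets it: such a cube is
   filled by all its children whenever the bound [h] permits, else by one. *)
Fixpoint greedy_mean (n : nat) : R :=
  if n is n'.+1 then
    if (n' < J)%N && (greedy_mean n' <= h n'.+1) then greedy_mean n'
    else greedy_mean n' / 2 ^+ d
  else 1.

(** Tells whether cubes of level [j - n.+1] meeting the set keep all their children. The cutoff at
    [J] confines the set to one cube of level [j - J]. *)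
Definition greedy_full n := (n < J)%N && (greedy_mean n <= h n.+1).

Definition cantor_cube n k : bool :=
  [forall i, allowed greedy_full n (tnth k i)].

(** The weights are indicators of admissible positions: all [2 ^+ d] children of a full cube,
    otherwise only the one at the zero corner. *)
Lemma dyadic_mean_cantor n k :
  dyadic_mean (fun m => (cantor_cube 0 m)%:R) n k =
  (cantor_cube n k)%:R * greedy_mean n.
Proof.
apply: (@dyadic_mean_product (fun n k => (cantor_cube n k)%:R)
  (fun n e => [forall i, tnth e i ==> greedy_full n]%:R)) => // {k}n => [|k e].
  rewrite /= -/(greedy_full n); case: ifP => _.
    rewrite (eq_bigr (fun=> 1)) => [|e _]; last first.
      by rewrite (_ : [forall _, _]) //; apply/forallP => i; rewrite implybT.
    by rewrite sumr_const card_tuple card_bool natrX mulVf ?mulr1// expf_neq0.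
  rewrite (bigD1 [tuple false | _ < d])//= big1 ?addr0 => [|e eF].
    rewrite (_ : [forall _, _]) ?mulr1//.
    by apply/forallP => i; rewrite tnth_mktuple.
  rewrite (_ : [forall _, _] = false)//; apply: contraNF eF => /forallP H.
  apply/eqP/eq_from_tnth => i; rewrite tnth_mktuple.
  by apply/negbTE; have := H i; rewrite implybF.
rewrite -natrM mulnb; congr (_%:R); apply: congr1; rewrite /cantor_cube.
apply/forallP/andP => [H|[/forallP H1 /forallP H2] i].
  by split; apply/forallP => i; have := H i;
    rewrite tnth_mktuple allowed_child => /andP[].
by rewrite tnth_mktuple allowed_child H1 H2.
Qed.

Lemma cantor_cube0 n : cantor_cube n [tuple 0 | _ < d].
Proof. by apply/forallP => i; rewrite tnth_mktuple allowed0. Qed.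

Hypotheses (h0 : h 0%N = 1) (h_dec : forall n, h n.+1 <= h n)
  (h_dbl : forall n, h n <= 2 ^+ d * h n.+1).

Lemma greedy_mean_gt0 n : 0 < greedy_mean n.
Proof. by elim: n => //= n IH; case: ifP => // _; rewrite divr_gt0 ?exprn_gt0. Qed.

(** When the density is divided by [2 ^+ d], the doubling bound [h_dbl] pays for the possible drop
    of [h]. *)
Lemma greedy_mean_le n : greedy_mean n <= h n.
Proof.
elim: n => [|n IH] /=; first by rewrite h0.
case: ifP => [/andP[]//|_].
by rewrite ler_pdivrMr ?exprn_gt0// mulrC (le_trans IH).
Qed.

(** The loss does not accumulate: a density is divided only when it exceeds [h n.+1], and then it
    stays above [h n.+1 / 2 ^+ d]. *)
Lemma greedy_mean_ge n : (n <= J)%N -> h n / 2 ^+ d <= greedy_mean n.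
Proof.
have pd : 1 <= 2 ^+ d :> R by rewrite exprn_ege1 ?ler1n.
elim: n => [|n IH] nJ /=.
  by rewrite h0 ler_pdivrMr ?exprn_gt0// mul1r.
rewrite nJ /=; have [_|/ltW hn] := leP (greedy_mean n) (h n.+1).
  by apply: le_trans (IH (ltnW nJ)); rewrite ler_pM2r ?invr_gt0 ?exprn_gt0.
by rewrite ler_pM2r ?invr_gt0 ?exprn_gt0.
Qed.

End greedy.

Lemma exists_cantor_set (h : nat -> R) (J : nat) :
    h 0%N = 1 -> (forall n, h n.+1 <= h n) -> (forall n, h n <= 2 ^+ d * h n.+1) ->
  exists E : d.-tuple int -> bool,
    (forall n k, dyadic_mean (fun m => (E m)%:R) n k <= h n) /\
    h J / 2 ^+ d <= dyadic_mean (fun m => (E m)%:R) J [tuple 0 | _ < d].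
Proof.
move=> h0 h_dec h_dbl; exists (cantor_cube h J 0); split=> [n k|].
  rewrite dyadic_mean_cantor; apply: le_trans (greedy_mean_le J h0 h_dbl n).
  by rewrite ler_piMl ?lern1 ?leq_b1// ltW// greedy_mean_gt0.
by rewrite dyadic_mean_cantor cantor_cube0 mul1r greedy_mean_ge.
Qed.

End cantor_sets.

(** * Functions nearly attaining the comparison constant *)

Section extremal_functions.
Context {R : realType} {d : nat}.

Lemma abs_pow_indicator (p A : R) (E : d.-tuple int -> bool) : 0 < p -> 0 <= A ->
  abs_pow p (fun m => (A * (E m)%:R)%:C%C) = (fun m => A `^ p * (E m)%:R).
Proof.
move=> p0 A0; apply/funext => m; rewrite /abs_pow /=.
rewrite expr0n addr0 sqrtr_sqr ger0_norm ?mulr_ge0//.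
by case: (E m); rewrite ?mulr1// !mulr0 powR0// gt_eqF.
Qed.

Context {p1 p2 : R} {phi1 phi2 : R -> R}.
Hypotheses (p1_gt0 : 0 < p1) (p2_gt0 : 0 < p2).
Hypotheses (phi1G : growth_class d p1 phi1) (phi2G : growth_class d p2 phi2).

(** The growth condition between a side and its double, raised to the power [p1]; it supplies the
    doubling hypothesis on Cantor densities. *)
Lemma growth_class_double (i : int) :
  phi1 (side (i - 1)) `^ p1 <= 2 ^+ d * phi1 (side i) `^ p1.
Proof.
have [gt0 _ dbl] := phi1G.
have s0 : 0 < side i :> R := side_gt0 i.
have sE : side (i - 1) = 2 * side i :> R.
  by rewrite -[in RHS](subrK 1 i) side_succ mulrC divfK.
have := @dbl (side i) (side (i - 1)) s0.
rewrite sE ler_peMl ?ler1n ?(ltW s0)// => /(_ isT).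
rewrite powRM ?(ltW s0)// mulrA ler_pM2r ?powR_gt0// => H.
have pos : 0 <= phi1 (2 * side i) * 2 `^ (- (d%:R / p1)).
  by rewrite mulr_ge0 ?powR_ge0// ltW// gt0// mulr_gt0.
move: H; rewrite -(@ler_powR_base _ p1)//; last exact/ltW/gt0.
rewrite powRM ?powR_ge0//; last by rewrite ltW// gt0// mulr_gt0.
rewrite -powRrM mulNr divfK ?gt_eqF// powRN powR_mulrn// ler_pdivrMr ?exprn_gt0//.
by rewrite [_ * 2 ^+ d]mulrC.
Qed.

(* A multiple [t / f] of the indicator of a Cantor set of density about
   [(f / phi1 (2^-(j-n)))^p1] in the cubes of level [j - n]; [f] is the value of
   phi1 at the fine scale if [p1 < p2] and at the coarse scale otherwise. *)
Lemma extremal_function (j J : nat) (t f : R) : 0 <= t -> 0 < f ->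
    phi1 (side j%:Z) <= f -> f <= phi1 (side (j%:Z - J%:Z)) ->
  exists c : d.-tuple int -> R[i],
    (morrey_norm phi1 p1 (step_fun c j) <= t%:E)%E /\
    ((t * (phi2 (side (j%:Z - J%:Z)) * 2 `^ (- (d%:R / p2)) *
        (f / phi1 (side (j%:Z - J%:Z))) `^ (p1 / p2) / f))%:E <=
      morrey_norm phi2 p2 (step_fun c j))%E.
Proof.
have [gt0 nd _] := phi1G; have [gt02 nd2 _] := phi2G.
move=> t0 f0 fj fJ.
have F0 i : 0 < phi1 (side i) by rewrite gt0 ?side_gt0.
have fF0 i : 0 <= f / phi1 (side i) by rewrite ltW// divr_gt0.
(* At height [t / f] a set of density [x n] in a cube of level [j - n] gives there a Morrey term
   equal to [t]. Densities cannot exceed 1, hence the cap in [h]. *)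
pose x n := (f / phi1 (side (j%:Z - n%:Z))) `^ p1.
pose h n := Num.min 1 (x n).
have mono n : phi1 (side (j%:Z - n%:Z)) <= phi1 (side (j%:Z - n.+1%:Z)).
  apply: nd; first exact: side_gt0.
  have -> : j%:Z - n%:Z = (j%:Z - n.+1%:Z) + 1 by lia.
  by rewrite side_succ ler_pdivrMr// ler_peMr ?ler1n// ltW// side_gt0.
have x_dec n : x n.+1 <= x n.
  by rewrite ler_powR_base ?fF0// ler_pM2l// lef_pV2 ?posrE ?F0 ?mono.
have x_dbl n : x n <= 2 ^+ d * x n.+1.
  have := growth_class_double (j%:Z - n%:Z).
  have -> : j%:Z - n%:Z - 1 = j%:Z - n.+1%:Z by lia.
  have P0 i : 0 < phi1 (side i) `^ p1 by rewrite powR_gt0.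
  have xE m : x m = f `^ p1 / phi1 (side (j%:Z - m%:Z)) `^ p1.
    by rewrite /x powRM ?invr_ge0 ?(ltW f0) ?(ltW (F0 _))// -powR_inv1 ?(ltW (F0 _))// powRAC powR_inv1 ?powR_ge0.
  rewrite !xE mulrCA ler_pM2l ?powR_gt0// ler_pdivlMr// => H.
  by rewrite mulrC ler_pdivrMr.
have one : 1 = 1 `^ p1 :> R by rewrite powR1.
have [||n|E [EU EL]] := @exists_cantor_set R d h J.
- rewrite /h /x subr0; apply/min_idPl; rewrite [leLHS]one ler_powR_base//.
  by rewrite ler_pdivlMr// mul1r.
- by move=> n; rewrite /h le_min ge_min lexx /= ge_min x_dec orbT.
- rewrite /h; have [x1|x1] := leP 1 (x n.+1); rewrite ge_min ?x_dbl ?orbT//.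
  by rewrite mulr1 exprn_ege1 ?ler1n.
have A0 : 0 <= t / f by rewrite divr_ge0 ?(ltW f0).
have m0 n k : 0 <= dyadic_mean (fun m => (E m)%:R) n k :> R.
  exact: dyadic_mean_ge0.
have powK p : 0 < p -> ((t / f) `^ p) `^ p^-1 = t / f.
  by move=> p0; rewrite -powRrM mulfV ?gt_eqF// powRr1.
exists (fun m => (t / f * (E m)%:R)%:C%C); split.
  apply: morrey_norm_le => // n k.
  rewrite abs_pow_indicator// dyadic_meanZ powRM ?powR_ge0// powK//.
  have : dyadic_mean (fun m => (E m)%:R) n k <= x n.
    by apply: le_trans (EU n k) _; rewrite ge_min lexx orbT.
  rewrite -(@ler_powR_base _ p1^-1) ?invr_gt0 ?powR_ge0//.
  rewrite -[leRHS]powRrM mulfV ?gt_eqF// powRr1; last first.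
    exact: fF0.
  move=> H; rewrite mulrCA; apply: le_trans (ler_wpM2l A0 (ler_wpM2l (ltW (F0 _)) H)) _.
  by rewrite le_eqVlt; apply/orP; left; apply/eqP; field; rewrite !gt_eqF.
apply: le_trans (morrey_norm_ge p2 _ j J [tuple 0 | _ < d]).
rewrite lee_fin abs_pow_indicator// dyadic_meanZ [in leRHS]powRM ?powR_ge0// powK//.
have -> : t * (phi2 (side (j%:Z - J%:Z)) * 2 `^ (- (d%:R / p2)) *
    (f / phi1 (side (j%:Z - J%:Z))) `^ (p1 / p2) / f) =
  phi2 (side (j%:Z - J%:Z)) * (t / f * (2 `^ (- (d%:R / p2)) *
    (f / phi1 (side (j%:Z - J%:Z))) `^ (p1 / p2))) by ring.
rewrite ler_wpM2l//; first by rewrite ltW// gt02// side_gt0.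
rewrite ler_wpM2l//.
(* The cap is inactive at level [j - J] because [f] is at most the value of [phi1] there. *)
have hJ : h J = x J.
  apply/min_idPr; rewrite [leRHS]one ler_powR_base//.
  by rewrite ler_pdivrMr// mul1r.
move: EL; rewrite hJ -(@ler_powR_base _ p2^-1) ?invr_gt0//; last first.
  by rewrite divr_ge0 ?powR_ge0// exprn_ge0.
apply: le_trans; rewrite [leRHS]powRM ?powR_ge0 ?invr_ge0 ?exprn_ge0//.
by rewrite /x -[in leRHS]powRrM mulrC -powR_invn// -[in leRHS]powRrM mulNr.
Qed.

End extremal_functions.

(** * The embedding criterion *)

Section embedding.
Context {R : realType} {d : nat} {s1 s2 p1 p2 : R} {q1 q2 : \bar R}.
Context {phi1 phi2 : R -> R}.
Hypotheses (p1_gt0 : 0 < p1) (p2_gt0 : 0 < p2).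
Hypotheses (q1_gt0 : (0 < q1)%E) (q2_gt0 : (0 < q2)%E).
Hypotheses (phi1G : growth_class d p1 phi1) (phi2G : growth_class d p2 phi2).
Let rho := Num.min 1 (p1 / p2).
Let n1 := @n_norm R d s1 phi1 p1 q1.
Let n2 := @n_norm R d s2 phi2 p2 q2.
Let ratio (nu : int) : R := phi2 (side nu) / phi1 (side nu) `^ rho.
Let rescale (j : nat) : R := phi1 (side j%:Z) `^ rho / phi1 (side j%:Z).
Let weight (s : R) (j : nat) : R := 2 `^ (j%:R * s).

Let phi1_gt0 i : 0 < phi1 (side i).
Proof. by have [gt0 _ _] := phi1G; exact/gt0/side_gt0. Qed.

Let phi2_gt0 i : 0 < phi2 (side i).
Proof. by have [gt0 _ _] := phi2G; exact/gt0/side_gt0. Qed.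

Let ratio_gt0 nu : 0 < ratio nu.
Proof. by rewrite divr_gt0// powR_gt0. Qed.

Let rescale_gt0 j : 0 < rescale j.
Proof. by rewrite divr_gt0// powR_gt0. Qed.

Let weight_gt0 s j : 0 < weight s j.
Proof. exact: powR_gt0. Qed.

Lemma weightB j : weight s2 j = weight (s2 - s1) j * weight s1 j.
Proof. by rewrite /weight -powRD ?(gt_eqF ltr0n) ?pnatr_eq0 ?implybT// -mulrDr subrK. Qed.

Lemma morrey_comparison (c : d.-tuple int -> R[i]) (j : nat) (A K : R) :
    0 <= A -> (morrey_norm phi1 p1 (step_fun c j) <= A%:E)%E ->
    (forall n : nat, ratio (j%:Z - n%:Z) <= K) ->
  (morrey_norm phi2 p2 (step_fun c j) <= (K * rescale j * A)%:E)%E.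
Proof.
have [gt01 nd1 _] := phi1G; have [gt02 nd2 _] := phi2G.
move=> A0 MA rK; apply: morrey_norm_le => // n k.
have K0 : 0 < K by exact: lt_le_trans (rK 0%N).
have X0 : 0 < K * rescale j by rewrite mulr_gt0.
(* The comparison of means asks for a positive bound, so [A] is enlarged by an amount that
   contributes exactly [e] to the result. *)
apply/ler_addgt0Pr => e e0.
have -> : K * rescale j * A + e = K * rescale j * (A + e / (K * rescale j)).
  by rewrite mulrDr [_ * (e / _)]mulrC divfK ?gt_eqF.
apply: (dyadic_mean_comparison p1_gt0 p2_gt0 gt01 gt02).
- by rewrite ltr_wpDl// divr_gt0.
- move=> n' k'; rewrite -lee_fin.
  apply: le_trans (morrey_norm_ge p1 _ j n' k') _; apply: le_trans MA _.
  by rewrite lee_fin lerDl divr_ge0 ?ltW.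
- by move=> n'; rewrite -ler_pdivrMr ?powR_gt0//; exact: rK.
Qed.

Lemma extremal_sequence (j J : nat) (t : R) : 0 <= t ->
  exists c : d.-tuple int -> R[i],
    (morrey_norm phi1 p1 (step_fun c j) <= t%:E)%E /\
    ((t * (2 `^ (- (d%:R / p2)) * ratio (j%:Z - J%:Z) * rescale j))%:E <=
      morrey_norm phi2 p2 (step_fun c j))%E.
Proof.
have [gt01 nd1 _] := phi1G.
move=> t0; rewrite /ratio /rescale.
have jJ : phi1 (side j%:Z) <= phi1 (side (j%:Z - J%:Z)).
  apply: nd1; first exact: side_gt0.
  rewrite /side opprB addrC exprzDr ?unitfE// ler_peMr ?exprz_ge0//.
  by rewrite -exprnP exprn_ege1// ler1n.
rewrite /rho; have [p21|p12] := leP 1 (p1 / p2).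
  (* With [f] taken at the coarse scale the density bound is 1 up to step [J]: the Cantor set is a
     whole cube. *)
  have [c [c1 c2]] := extremal_function p1_gt0 p2_gt0 phi1G phi2G t0
    (phi1_gt0 (j%:Z - J%:Z)) jJ (lexx _).
  exists c; split=> //; apply: le_trans c2; rewrite lee_fin.
  rewrite !powRr1 ?(ltW (phi1_gt0 _))// !divff ?gt_eqF// powR1 !mulr1.
  by rewrite mulrCA mulrA mulrC; rewrite le_eqVlt; apply/orP; left; apply/eqP; ring.
(* With [f] taken at the fine scale the set is as dense at every scale as the first norm allows, up
   to a constant. *)
have [c [c1 c2]] := extremal_function p1_gt0 p2_gt0 phi1G phi2G t0
    (phi1_gt0 j%:Z) (lexx _) jJ.
exists c; split=> //; apply: le_trans c2; rewrite lee_fin.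
rewrite powRM ?invr_ge0 ?(ltW (phi1_gt0 _))//.
rewrite -[(phi1 (side (j%:Z - J%:Z)))^-1]powR_inv1 ?(ltW (phi1_gt0 _))//.
rewrite powRAC powR_inv1 ?powR_ge0//.
by rewrite le_eqVlt; apply/orP; left; apply/eqP; ring.
Qed.

Let terms (s p : R) phi (lam : nat -> d.-tuple int -> R[i]) j : \bar R :=
  ((weight s j)%:E * morrey_norm phi p (step_fun (lam j) j))%E.

Let terms1_ge0 lam j : (0 <= terms s1 p1 phi1 lam j)%E.
Proof.
have [gt01 _ _] := phi1G.
by rewrite mule_ge0 ?lee_fin ?(ltW (weight_gt0 _ _))// morrey_norm_ge0.
Qed.

Let terms2_ge0 lam j : (0 <= terms s2 p2 phi2 lam j)%E.
Proof.
have [gt01 _ _] := phi2G.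
by rewrite mule_ge0 ?lee_fin ?(ltW (weight_gt0 _ _))// morrey_norm_ge0.
Qed.

Lemma n_norm0 : n1 0 = 0%E.
Proof.
have [gt01 nd1 _] := phi1G.
apply/eqP; rewrite eq_le Lnorm_ge0 andbT.
apply: (@ell_norm_le_bound _ _ _ (fun=> 0)) => // [k|j|].
- exact: terms1_ge0.
- rewrite -[leRHS](mule0 (weight s1 j)%:E) lee_pmul2l//.
  apply: morrey_norm_le => // n k.
  have -> : abs_pow p1 (0 : d.-tuple int -> R[i]) = fun m => 0 * 0.
    by apply/funext => m; rewrite /abs_pow Normc.normc0 powR0 ?mulr0// gt_eqF.
  by rewrite dyadic_meanZ mul0r powR0 ?mulr0// invr_eq0 gt_eqF.
- case: q1 q1_gt0 => [r| |]//=; rewrite lte_fin => r0 K.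
  by rewrite powR0 ?gt_eqF// big1.
Qed.

Let ratio_le_alpha (j n : nat) : ((ratio (j%:Z - n%:Z))%:E <= alpha phi1 phi2 rho j)%E.
Proof. by apply: ereal_sup_ubound; exists (j%:Z - n%:Z) => //=; lia. Qed.

Let alpha_gt0 j : (0 < alpha phi1 phi2 rho j)%E.
Proof. by apply: lt_le_trans (ratio_le_alpha j 0); rewrite lte_fin. Qed.

(** * Necessity of both conditions, from continuity at 0 *)

Section necessity.
Variable r : R.
Hypothesis r_gt0 : 0 < r.
Hypothesis embedded : forall lam, (n1 lam < r%:E)%E -> (n2 lam < 1)%E.
(** The loss in [extremal_sequence] times the size of the test sequences, which [r / 2] keeps
    strictly inside the ball of radius [r]. *)
Let kappa := 2 `^ (- (d%:R / p2)) * (r / 2).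

(** For [a] in the unit ball of the source sequence space, one extremal function per level, scaled
    by [a j], is assembled into a sequence to which [embedded] applies; duality then bounds the
    multiplier. The coarse scale [J j] stays free at each level. *)
Lemma necessity_bound (J : nat -> nat) :
  ell_bound (qstar q1 q2) (fun j =>
    weight (s2 - s1) j * ratio (j%:Z - (J j)%:Z) * rescale j * kappa) 1.
Proof.
have kappa0 : 0 < kappa by rewrite mulr_gt0 ?powR_gt0// divr_gt0.
have b0 j : 0 <= weight (s2 - s1) j * ratio (j%:Z - (J j)%:Z) * rescale j * kappa.
  by apply/ltW; rewrite mulr_gt0// mulr_gt0// mulr_gt0.
apply: ell_bound_dual => // a a0 a1.
(* Dividing by the source weight makes the [j]-th term of the source quasi-norm at most
   [r / 2 * a j]. *)
pose t j := r / 2 * a j / weight s1 j.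
have r2 : 0 <= r / 2 by rewrite divr_ge0// ltW.
have t0 j : 0 <= t j by rewrite divr_ge0 ?(ltW (weight_gt0 _ _))// mulr_ge0.
have [c cP] := choice (fun j => extremal_sequence j (J j) (t0 j)).
apply: (@ell_bound_le_norm _ _ (terms s2 p2 phi2 c)) => // [j|j|].
- by rewrite mulr_ge0.
- have [_ c2] := cP j.
  apply: le_trans (lee_wpmul2l _ c2); last by rewrite lee_fin ltW.
  rewrite -EFinM lee_fin -/(ratio _) -/(rescale _) weightB /t /kappa.
  rewrite le_eqVlt; apply/orP; left; apply/eqP; field.
  by rewrite gt_eqF.
apply/ltW/embedded; apply: (@le_lt_trans _ _ (r / 2)%:E); last first.
  by rewrite lte_fin ltr_pdivrMr// ltr_pMr// ltr1n.
apply: (@ell_norm_le_bound _ _ _ (fun j => r / 2 * a j)) => //.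
- by move=> j; exact: terms1_ge0.
- move=> j; have [c1 _] := cP j.
  apply: le_trans (lee_wpmul2l _ c1) _; first by rewrite lee_fin ltW.
  by rewrite -EFinM lee_fin /t mulrC divfK// gt_eqF.
- rewrite -[X in ell_bound _ _ X](mulr1 (r / 2)).
  exact: ell_boundZ.
Qed.

(** The bound is independent of [J], so it shows that [alpha] is finite; its case [j = 0] gives the
    first condition of the criterion. *)
Lemma necessity_term (j J : nat) :
  ratio (j%:Z - J%:Z) <= (weight (s2 - s1) j * rescale j * kappa)^-1.
Proof.
have kappa0 : 0 < kappa by rewrite mulr_gt0 ?powR_gt0// divr_gt0.
have := @ell_bound_term _ _ _ _ j (qstar_gt0 q1_gt0 q2_gt0) _ ler01
  (necessity_bound (fun=> J)).
have P0 : 0 < weight (s2 - s1) j * rescale j * kappa by rewrite mulr_gt0// mulr_gt0.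
rewrite -[_^-1]mul1r ler_pdivlMr//.
move=> H; apply: le_trans (H _); last by move=> i; apply/ltW; rewrite mulr_gt0// mulr_gt0// mulr_gt0.
by rewrite le_eqVlt; apply/orP; left; apply/eqP; ring.
Qed.

Lemma necessity_ratio :
  (ereal_sup [set (ratio nu)%:E | nu in [set nu : int | (nu <= 0)%R]] < +oo)%E.
Proof.
apply: le_lt_trans (ltry (weight (s2 - s1) 0 * rescale 0 * kappa)^-1).
apply: ge_ereal_sup => _ [nu /= nu0 <-]; rewrite lee_fin.
have -> : nu = 0%N%:Z - `|nu|%N%:Z by lia.
exact: necessity_term.
Qed.

Lemma necessity_ell :
  (ell_norm (qstar q1 q2) (fun j : nat =>
     (weight (s2 - s1) j)%:E * alpha phi1 phi2 rho j * (rescale j)%:E) < +oo)%E.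
Proof.
have kappa0 : 0 < kappa by rewrite mulr_gt0 ?powR_gt0// divr_gt0.
(* Since [alpha] is finite and positive, some scale attains at least half of the supremum;
   [necessity_bound] is used with these scales. *)
have /choice[J JP] (j : nat) : exists J : nat,
    (alpha phi1 phi2 rho j <= (2 * ratio (j%:Z - J%:Z))%:E)%E.
  have : (alpha phi1 phi2 rho j <=
      ((weight (s2 - s1) j * rescale j * kappa)^-1)%:E)%E.
    apply: ge_ereal_sup => _ [nu /= nuj <-]; rewrite lee_fin.
    have -> : nu = j%:Z - `|j%:Z - nu|%N%:Z by lia.
    exact: necessity_term.
  have := alpha_gt0 j; case E : (alpha _ _ _ j) => [x| |]//.
  rewrite lte_fin => x0 _.
  have : ((x / 2)%:E < alpha phi1 phi2 rho j)%E.
    by rewrite E lte_fin ltr_pdivrMr// ltr_pMr// ltr1n.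
  move=> /ereal_sup_gt[_ [nu /= nuj <-]]; rewrite lte_fin => xnu.
  exists `|j%:Z - nu|%N; have -> : j%:Z - `|j%:Z - nu|%N%:Z = nu by lia.
  by rewrite lee_fin mulrC -ler_pdivrMr// ltW.
apply: le_lt_trans (ltry (2 / kappa * 1)).
have b0 j : 0 <= weight (s2 - s1) j * ratio (j%:Z - (J j)%:Z) * rescale j * kappa.
  by apply/ltW; rewrite mulr_gt0// mulr_gt0// mulr_gt0.
have k20 : 0 <= 2 / kappa by rewrite divr_ge0 ?ltW.
apply: ell_norm_le_bound (ell_boundZ (qstar_gt0 _ _) b0 ler01 k20 (necessity_bound J)) => //.
- exact: qstar_gt0.
- by rewrite mulr1.
- by move=> j; rewrite !mule_ge0 ?lee_fin ?ltW.
- move=> j; apply: (@le_trans _ _ ((weight (s2 - s1) j)%:E *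
      (2 * ratio (j%:Z - (J j)%:Z))%:E * (rescale j)%:E)%E).
    apply: lee_wpmul2r; first by rewrite lee_fin ltW.
    by apply: lee_wpmul2l; first by rewrite lee_fin ltW.
  rewrite -!EFinM lee_fin le_eqVlt; apply/orP; left; apply/eqP; field.
  by rewrite gt_eqF.
Qed.

End necessity.

(** [morrey_comparison] with [K = alpha] acts level by level, and [ell_boundM] sums the levels. *)
Lemma sufficiency :
    (ell_norm (qstar q1 q2) (fun j : nat =>
      (weight (s2 - s1) j)%:E * alpha phi1 phi2 rho j * (rescale j)%:E) < +oo)%E ->
  exists2 D : R, 0 < D & forall lam (r : R), 0 < r ->
    (n1 lam <= r%:E)%E -> (n2 lam <= (r * D)%:E)%E.
Proof.
move=> /ell_norm_ltyP[||b [B [bE b0 B0 bB]]].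
- exact: qstar_gt0.
- by move=> j; rewrite !mule_ge0 ?lee_fin ?ltW.
(* An infinite [alpha] would give an infinite term, since the factors around it are positive. *)
have alphaE j : alpha phi1 phi2 rho j = (fine (alpha phi1 phi2 rho j))%:E.
  have := alpha_gt0 j; have := congr1 (fun f => f j) bE => /=.
  case: (alpha _ _ _ j) => [x| |]//.
  by rewrite gt0_muley ?lte_fin// gt0_mulye ?lte_fin.
set K := fun j => fine (alpha phi1 phi2 rho j).
have bKE j : b j = weight (s2 - s1) j * K j * rescale j.
  by apply: EFin_inj; rewrite !EFinM -alphaE; have := congr1 (fun f => f j) bE.
have ratioK (j n : nat) : ratio (j%:Z - n%:Z) <= K j.
  by rewrite -lee_fin -alphaE.
have [D D0 HD] := ell_boundM q1_gt0 q2_gt0 b0 B0 bB.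
exists D => // lam r r0 lam1.
have U0 := terms1_ge0 lam.
have Ule j : (terms s1 p1 phi1 lam j <= r%:E)%E.
  by apply: le_trans lam1; exact: (ell_norm_ge_term j q1_gt0 U0).
pose u j := fine (terms s1 p1 phi1 lam j).
have uE j : terms s1 p1 phi1 lam j = (u j)%:E.
  by rewrite fineK// ge0_fin_numE// (le_lt_trans (Ule j)) ?ltry.
have u0 j : 0 <= u j by exact: fine_ge0.
have ub : ell_bound q1 u r.
  apply: (@ell_bound_le_norm _ _ (terms s1 p1 phi1 lam)) => // [|j].
    exact: ltW.
  by rewrite uE.
apply: ell_norm_le_bound (HD u r u0 r0 ub) => //.
- by rewrite mulr_ge0 ?ltW.
- by move=> j; exact: terms2_ge0.
move=> j.
have A0 : 0 <= u j / weight s1 j by rewrite divr_ge0// ltW.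
have M1 : (morrey_norm phi1 p1 (step_fun (lam j) j) <= (u j / weight s1 j)%:E)%E.
  rewrite -(@lee_pmul2l _ (weight s1 j)%:E) ?lte_fin//.
  by rewrite -/(terms _ _ _ _ _) uE -EFinM lee_fin mulrC divfK// gt_eqF.
have M2 := morrey_comparison A0 M1 (ratioK j).
apply: le_trans (lee_wpmul2l _ M2) _; first by rewrite lee_fin ltW.
rewrite -EFinM lee_fin bKE -/(weight s2 j) weightB le_eqVlt; apply/orP; left; apply/eqP; field.
by rewrite gt_eqF.
Qed.

Lemma embedding_criterion :
  continuously_embedded n1 n2 <->
    (ereal_sup [set (ratio nu)%:E | nu in [set nu : int | (nu <= 0)%R]] < +oo)%E /\
    (ell_norm (qstar q1 q2) (fun j : nat =>
      (weight (s2 - s1) j)%:E * alpha phi1 phi2 rho j * (rescale j)%:E) < +oo)%E.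
Proof.
(* Necessity tests continuity at the point 0 with target radius 1. *)
split=> [[_ /(_ 0)]|[_ /sufficiency[D D0 HD]]].
  rewrite /gauge_space /= n_norm0 ltry => /(_ isT 1 ltr01)[r r0 H].
  have {}H lam : (n1 lam < r%:E)%E -> (n2 lam < 1)%E.
    by move=> lamr; have := H lam; rewrite subr0; apply=> //; exact: lt_trans lamr (ltry _).
  by split; [exact: necessity_ratio H|exact: necessity_ell H].
split=> [lam|lam _ e e0].
  rewrite /gauge_space /= => lamy.
  have lam0 : (0 <= n1 lam)%E by exact: Lnorm_ge0.
  have fin : n1 lam \is a fin_num by rewrite ge0_fin_numE.
  (* Adding 1 makes the radius positive even when the quasi-norm of [lam] vanishes. *)
  apply: le_lt_trans (HD lam (fine (n1 lam) + 1) _ _) (ltry _).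
    by rewrite ltr_wpDl// fine_ge0.
  by rewrite EFinD fineK// leeDl.
exists (e / (2 * D)); first by rewrite divr_gt0// mulr_gt0.
move=> y _ /ltW/HD - /(_ (divr_gt0 e0 (mulr_gt0 (ltr0n _ 2) D0))) H.
apply: le_lt_trans H _; rewrite lte_fin invfM mulrA divfK ?gt_eqF//.
by rewrite ltr_pdivrMr// ltr_pMr// ltr1n.
Qed.

End embedding.

(** * Noncompactness *)

Section noncompactness.
Context {R : realType} {d : nat}.
Hypothesis d_gt0 : (0 < d)%N.

(** Only the ancestors of [m0] have a nonzero mean, and each generation divides it by [2 ^+ d]. *)
Lemma dyadic_mean_delta (m0 : d.-tuple int) n k :
  dyadic_mean (fun m => (m == m0)%:R : R) n k <= ((2 ^+ d)^-1) ^+ n.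
Proof.
rewrite (@dyadic_mean_product _ _ (fun n k => (k == iter n parent m0)%:R)
  (fun n e => (e == parity (iter n parent m0))%:R) (fun n => (2 ^+ d)^-1 ^+ n))//.
- by rewrite ler_piMl ?exprn_ge0 ?invr_ge0 ?exprn_ge0// lern1 leq_b1.
- move=> {}n; rewrite exprSr (bigD1 (parity (iter n parent m0)))//= eqxx big1 ?addr0 ?mulr1//.
  by move=> e /negbTE ->.
- by move=> {}n {}k e; rewrite eq_child -natrM mulnb.
Qed.

Definition unit_sequence (n : nat) : nat -> d.-tuple int -> R[i] :=
  fun j m => (1 * ((j == 0%N) && (m == [tuple n%:Z | _ < d]))%:R)%:C%C.

Lemma unit_sequence_neq (n n' : nat) : n != n' ->
  unit_sequence n 0 [tuple n'%:Z | _ < d] = 0.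
Proof.
move=> nn'; rewrite /unit_sequence eqxx /=.
case: eqP => [/(congr1 (fun t => tnth t (Ordinal d_gt0)))|_].
  by rewrite !tnth_mktuple => -[] /esym/eqP; rewrite (negbTE nn').
by rewrite mulr0.
Qed.

(** On coarse cubes the growth of [phi], normalised at 1, is compensated by the decay of the mean of
    a single unit cube. *)
Lemma n_norm_unit_sequence (s p : R) (q : \bar R) (phi : R -> R) (n : nat) :
    0 < p -> (0 < q)%E -> growth_class d p phi -> phi 1 = 1 ->
  (n_norm s phi p q (unit_sequence n) <= 1)%E.
Proof.
move=> p0 q0 [gt0 nd dbl] phi1.
apply: (@ell_norm_le_bound _ _ _ (fun j => (j == 0%N)%:R)) => // [j|j|].
- by rewrite mule_ge0 ?lee_fin ?powR_ge0// morrey_norm_ge0.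
- have -> : ((j == 0%N)%:R%:E = (2 `^ (j%:R * s))%:E * (j == 0%N)%:R%:E :> \bar R)%E.
    by case: eqP => [->|_]; rewrite ?mul0r ?powRr0 ?mule1 ?mule0.
  apply: lee_wpmul2l; first by rewrite lee_fin powR_ge0.
  apply: morrey_norm_le => // i k.
  rewrite abs_pow_indicator// powR1.
  have -> : (fun m => 1 * ((j == 0%N) && (m == [tuple n%:Z | _ < d]))%:R) =
      (fun m => (j == 0%N)%:R * (m == [tuple n%:Z | _ < d])%:R) :> (d.-tuple int -> R).
    by apply/funext => m; rewrite mul1r -mulnb natrM.
  rewrite dyadic_meanZ; have [->|_] := eqVneq j 0%N; last first.
    by rewrite mul0r powR0 ?mulr0// invr_eq0 gt_eqF.
  rewrite mul1r sub0r; set s' := side _.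
  have s'E : s' = 2 ^+ i by rewrite /s' /side opprK.
  have s'0 : 0 < s' by exact: side_gt0.
  have : phi s' * s' `^ (- (d%:R / p)) <= 1.
    have := @dbl 1 s' ltr01; rewrite powR1 phi1 mulr1; apply.
    by rewrite s'E exprn_ege1// ler1n.
  apply: le_trans; rewrite ler_wpM2l ?(ltW (gt0 _ s'0))//.
  have -> : s' `^ (- (d%:R / p)) = ((2 ^+ d)^-1 ^+ i) `^ p^-1.
    rewrite -mulNr powRrM powRN powR_mulrn ?(ltW s'0)// s'E -exprM.
    by rewrite exprVn -exprM mulnC.
  rewrite ler_powR_base ?invr_gt0 ?exprn_ge0 ?invr_ge0 ?exprn_ge0//.
    exact: dyadic_mean_delta.
  exact: dyadic_mean_ge0.
- exact: ell_bound_delta.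
Qed.

(** The cube of level 0 with index [m], where [phi] equals 1, already contributes this
    coefficient. *)
Lemma n_norm_ge_coord (s p : R) (q : \bar R) (phi : R -> R) lam (m : d.-tuple int) :
    0 < p -> (0 < q)%E -> growth_class d p phi -> phi 1 = 1 ->
  ((Normc.normc (lam 0%N m))%:E <= n_norm s phi p q lam)%E.
Proof.
move=> p0 q0 [gt0 _ _] phi1.
have U0 j : (0 <= (2 `^ (j%:R * s))%:E * morrey_norm phi p (step_fun (lam j) j))%E.
  by rewrite mule_ge0 ?lee_fin ?powR_ge0// morrey_norm_ge0.
apply: le_trans (ell_norm_ge_term 0 q0 U0).
rewrite mul0r powRr0 mul1e.
apply: le_trans (morrey_norm_ge p (lam 0%N) 0 0 m).
rewrite subr0 /= /side oppr0 expr0z phi1 mul1r /abs_pow -powRrM mulfV ?gt_eqF//.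
by rewrite powRr1// normc_ge0.
Qed.

Lemma not_compactly_embedded (s1 s2 p1 p2 : R) (q1 q2 : \bar R) (phi1 phi2 : R -> R) :
    0 < p1 -> 0 < p2 -> (0 < q1)%E -> (0 < q2)%E ->
    growth_class d p1 phi1 -> growth_class d p2 phi2 -> phi1 1 = 1 -> phi2 1 = 1 ->
  ~ compactly_embedded (@n_norm R d s1 phi1 p1 q1) (@n_norm R d s2 phi2 p2 q2).
Proof.
move=> p10 p20 q10 q20 phi1G phi2G phi11 phi21 [_ /(_ unit_sequence)[]].
  by exists 1 => n; exact: n_norm_unit_sequence.
move=> sigma [sigma_inc [y _ cvg0]].
have /cvg0[N _ HN] : nbhs (0 : \bar R) [set x | (x < (2^-1)%:E)%E].
  by apply: (@nbhs_open_ereal_lt _ 0 (fun=> 2^-1)); rewrite invr_gt0.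
pose m : d.-tuple int := [tuple (sigma N)%:Z | _ < d].
have H n : (N <= n)%N -> Normc.normc ((unit_sequence (sigma n) - y) 0%N m) < 2^-1.
  move=> Nn; rewrite -lte_fin; apply: le_lt_trans (HN n Nn).
  exact: n_norm_ge_coord.
(* At index [m] the sequence number [sigma N] has coefficient 1 and number [sigma N.+1] has 0, so
   the limit's coefficient would be within less than 1/2 of both. *)
have := H N (leqnn N); have := H N.+1 (leqnSn N).
rewrite /= !fctE unit_sequence_neq; last first.
  by rewrite gtn_eqF// sigma_inc.
rewrite /unit_sequence !eqxx mulr1 sub0r => h1 h2.
have := le_normcD (1 - y 0%N m) (y 0%N m); rewrite subrK.
rewrite Normc.normc1 -(normcN (y 0%N m)) leNgt => /negP; apply.
by rewrite [ltRHS](splitr 1) mul1r ltrD.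
Qed.

End noncompactness.

Unset Implicit Arguments.

Theorem theorem4p1 (R : realType) (d : nat) (s1 s2 p1 p2 : R) (q1 q2 : \bar R)
    (phi1 phi2 : R -> R)
    (d_gt0 : (0 < d)%N)
    (p1_gt0 : 0 < p1) (p2_gt0 : 0 < p2)
    (q1_gt0 : (0 < q1)%E) (q2_gt0 : (0 < q2)%E)
    (phi1G : growth_class d p1 phi1) (phi2G : growth_class d p2 phi2)
    (phi1_1 : phi1 1 = 1) (phi2_1 : phi2 1 = 1) :
  let rho := Num.min 1 (p1 / p2) in
  let n1 := @n_norm R d s1 phi1 p1 q1 in
  let n2 := @n_norm R d s2 phi2 p2 q2 in
  (continuously_embedded n1 n2 <->
     (ereal_sup [set (phi2 (side nu) / phi1 (side nu) `^ rho)%:E |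
                 nu in [set nu : int | (nu <= 0)%R]] < +oo)%E /\
     (ell_norm (qstar q1 q2) (fun j : nat =>
        (2 `^ (j%:R * (s2 - s1)))%:E * alpha phi1 phi2 rho j *
        (phi1 (side j) `^ rho / phi1 (side j))%:E) < +oo)%E) /\
  ~ compactly_embedded n1 n2.
Proof.
by split; [exact: embedding_criterion|exact: not_compactly_embedded].
Qed.
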